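(* Let $H$ be a Hopf algebra over a field $k$ which is residually finite-dimensional and has an artinian classical quotient ring $Q=Q(H)$. Let $I$ be a coideal left ideal of $H$ and let $A$ be the corresponding left $H^\circ$-invariant artinian subalgebra of $Q$. Then the following conditions are equivalent: (a) $I$ is a biideal of $H$; (b) $I$ is a Hopf ideal of $H$; (c) $A$ is stable under the right adjoint action of $H$ on $Q$ defined by the rule $$q\triangleleft h=\sum S(h_{(1)})\,q\,h_{(2)},\qquad q\in Q,\ h\in H.$$
   Context: $H$ has comultiplication $\Delta(x)=\sum x_{(1)}\otimes x_{(2)}$, counit $\varepsilon$ and antipode $S$; $\otimes=\otimes_k$. $H$ is residually finite-dimensional if its two-sided ideals of finite codimension have zero intersection. An artinian classical quotient ring of $H$ is an overring $Q=Q(H)\supset H$, left and right artinian, in which all nonzerodivisors of $H$ are invertible and whose every element can be written as $as^{-1}$ and also as $t^{-1}b$ with $a,b,s,t\in H$ and $s,t$ nonzerodivisors. (Under these assumptions $S$ is bijective.) $H^\circ$ is the dual Hopf algebra (linear functions $H\to k$ vanishing on an ideal of finite codimension). It acts on $H$ from the left by $f\rightharpoonup h=\sum f(h_{(2)})h_{(1)}$; this action extends to $Q$, making $Q$ a left $H^\circ$-module algebra. A subalgebra of $Q$ is left $H^\circ$-invariant if it is stable under this action. A coideal left ideal is a coideal of $H$ which is also a left ideal. A biideal is a coideal which is also a two-sided ideal; a Hopf ideal is a biideal $I$ with $S(I)\subset I$. Correspondence: there is a bijection between the coideal left ideals $I$ of $H$ and the left $H^\circ$-invariant (left and right) artinian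 subalgebras $A$ of $Q$. Under it, $I=\{x\in H\mid \sum x_{(1)}\otimes_AS(x_{(2)})=0\text{ in }Q\otimes_AQ\}$, and $A=\{x\in Q\mid 1\otimes x-x\otimes1\in\mathcal I\}$, where $\mathcal I$ is the $Q$-subbimodule of $Q\otimes Q$ generated by the elements $\sum x_{(1)}\otimes S(x_{(2)})$ with $x\in I$. *)

(* Defs.v *)
From HB Require Import structures.
From mathcomp Require Import all_boot all_order all_algebra.
From mathcomp Require Import boolp classical_sets.
From mathcomp Require Import freeg.

Set Implicit Arguments.
Unset Strict Implicit.
Unset Printing Implicit Defensive.

Import GRing.Theory.
Local Open Scope classical_set_scope.
Local Open Scope ring_scope.
Local Open Scope quotient_scope.

(* [btensor ra la] is U (x)_S V, as the free abelian group on U * V modulo the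
   usual relations, for S acting on the right of U by [ra] and on the left of V
   by [la].  It is used with S a field or a subring. *)
Section BalancedTensor.
Variables (U V : zmodType) (S : Type) (ra : U -> S -> U) (la : S -> V -> V).

Notation gen u v := (<< (u, v) >> : {freeg (U * V)%type}).

Inductive btensor_gen : set {freeg (U * V)%type} :=
| Btensor_addl u1 u2 v : btensor_gen (gen (u1 + u2) v - gen u1 v - gen u2 v)
| Btensor_addr u v1 v2 : btensor_gen (gen u (v1 + v2) - gen u v1 - gen u v2)
| Btensor_bal u s v : btensor_gen (gen (ra u s) v - gen u (la s v)).

Definition btensor_rel : {pred {freeg (U * V)%type}} :=
  fun D => D \in smallest (fun X => zmod_closed [in X]) btensor_gen.

Lemma btensor_rel_closed : zmod_closed btensor_rel.
Proof.
split=> [|D1 D2]; first by rewrite unfold_in inE => X [[+ _] _]; rewrite inE.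
rewrite !unfold_in !inE => h1 h2 X /= hX; case: (hX) => [[_ hB] _].
have := hB D1 D2; rewrite !inE; apply; [exact: h1 | exact: h2].
Qed.
HB.instance Definition _ :=
  GRing.isZmodClosed.Build {freeg (U * V)%type} btensor_rel btensor_rel_closed.

Definition btensor : Type := Quotient.quot btensor_rel.
HB.instance Definition _ := GRing.Zmodule.on btensor.

Local Notation pi := (\pi_(Quotient.quot btensor_rel)).

Definition bpure (u : U) (v : V) : btensor := pi (gen u v).

(* The sum of F u_i v_i when t is written as the sum of the u_i (x) v_i; it
   depends only on t when F is balanced (see [bsumP]). *)
Definition bsum (W : zmodType) (F : U -> V -> W) (t : btensor) : W :=
  fglift (fun p : U * V => F p.1 p.2 : zmodule W)
    (repr (t : Quotient.quot btensor_rel)).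

Definition balanced (W : zmodType) (F : U -> V -> W) : Prop :=
  [/\ forall v, zmod_morphism (F^~ v), forall u, zmod_morphism (F u) &
      forall u s v, F (ra u s) v = F u (la s v)].

Lemma btensor_rel0 D : btensor_gen D -> pi D = 0.
Proof.
move=> hD; apply/eqP; rewrite -[0](raddf0 pi) -Quotient.idealrBE subr0.
by rewrite unfold_in inE; apply: sub_gen_smallest.
Qed.

Lemma bpure_addl u1 u2 v : bpure (u1 + u2) v = bpure u1 v + bpure u2 v.
Proof.
have := btensor_rel0 (Btensor_addl u1 u2 v).
by rewrite !raddfB => /eqP; rewrite -addrA -opprD subr_eq0 => /eqP.
Qed.

Lemma bpure_addr u v1 v2 : bpure u (v1 + v2) = bpure u v1 + bpure u v2.
Proof.
have := btensor_rel0 (Btensor_addr u v1 v2).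
by rewrite !raddfB => /eqP; rewrite -addrA -opprD subr_eq0 => /eqP.
Qed.

Lemma bpure_bal u s v : bpure (ra u s) v = bpure u (la s v).
Proof.
by have := btensor_rel0 (Btensor_bal u s v); rewrite raddfB => /subr0_eq.
Qed.

Lemma btensor_ind (P : btensor -> Prop) :
    P 0 -> (forall s t, P s -> P t -> P (s - t)) ->
    (forall u v, P (bpure u v)) -> forall t, P t.
Proof.
move=> P0 PB Pp t; rewrite -[t]reprK.
have PD s1 s2 : P s1 -> P s2 -> P (s1 + s2).
  by move=> h1 h2; rewrite -[s2]opprK -[- s2]sub0r; apply/PB/PB.
rewrite -[repr t]freeg_sumE raddf_sum; apply: big_ind => // -[u v] _.
have -> : << coeff (u, v) (repr t) *g (u, v) >> =
          << (u, v) >> *~ coeff (u, v) (repr t) :> {freeg (U * V)%type}.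
  by rewrite freegU_mulz intz.
rewrite raddfMz; case: (coeff _ _) => n; last rewrite NegzE mulrNz.
  by rewrite -pmulrn; elim: n => [|n IH]; rewrite ?mulr0n // mulrS; apply: PD (Pp u v) _.
rewrite -sub0r; apply: PB => //.
by rewrite -pmulrn; elim: n.+1 => [|m IH]; rewrite ?mulr0n // mulrS; apply: PD (Pp u v) _.
Qed.

Section Lift.
Variables (W : zmodType) (F : U -> V -> W).
Hypothesis Fbal : balanced F.

Let F' := fun p : U * V => F p.1 p.2 : zmodule W.

Let F'B : zmod_morphism (fglift F') := @lift_is_additive _ _ _ F'.

Lemma bsum_pi D : bsum F (pi D) = fglift F' D.
Proof.
rewrite /bsum; set D' := repr _.
have : btensor_rel (D' - D).
  have : D' == D %[mod Quotient.quot btensor_rel] by rewrite /D' reprK.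
  by rewrite -Quotient.idealrBE.
rewrite /btensor_rel inE => /(_ [set D | fglift F' D = 0]) h.
apply/eqP; rewrite -subr_eq0 -F'B; apply/eqP/h; split.
  split=> [|x y]; rewrite !inE /=.
    by rewrite -[0 in LHS](subrr 0) F'B subrr.
  by move=> hx hy; rewrite F'B hx hy subr0.
case: Fbal => Fl Fr Fb.
have FDl u1 u2 v : F (u1 + u2) v = F u1 v + F u2 v.
  by have := Fl v (u1 + u2) u2; rewrite addrK => ->; rewrite subrK.
have FDr u v1 v2 : F u (v1 + v2) = F u v1 + F u v2.
  by have := Fr u (v1 + v2) v2; rewrite addrK => ->; rewrite subrK.
move=> _ [u1 u2 v|u v1 v2|u s v] /=; rewrite !F'B /= !liftU !scale1r /F' /=.
- by rewrite FDl -addrA -opprD subrr.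
- by rewrite FDr -addrA -opprD subrr.
- by rewrite Fb subrr.
Qed.

Lemma bsum_additive : zmod_morphism (bsum F).
Proof.
move=> s t; rewrite -[s]reprK -[t]reprK -(raddfB pi) !bsum_pi.
exact: F'B.
Qed.

Lemma bsum_pure u v : bsum F (bpure u v) = F u v.
Proof. by rewrite /bpure bsum_pi /F' liftU scale1r. Qed.

End Lift.
End BalancedTensor.

Lemma zmod_morphismD (U V : zmodType) (f : U -> V) :
  zmod_morphism f -> {morph f : x y / x + y}.
Proof. by move=> fB x y; have := fB (x + y) y; rewrite addrK => ->; rewrite subrK. Qed.

Lemma zmod_morphism_ofD (U V : zmodType) (f : U -> V) :
  {morph f : x y / x + y} -> zmod_morphism f.
Proof. by move=> fD x y; apply: (addIr (f y)); rewrite -fD !subrK. Qed.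

Lemma zmod_morphism_sub (U V : zmodType) (f g : U -> V) :
  zmod_morphism f -> zmod_morphism g -> zmod_morphism (fun x => f x - g x).
Proof.
by move=> fB gB x y; rewrite fB gB !opprD !opprK addrACA.
Qed.

Section Tensor.
Variable k : comNzRingType.

Definition tensor (U V : lmodType k) : Type :=
  btensor (fun (u : U) (c : k) => c *: u) (fun (c : k) (v : V) => c *: v).
HB.instance Definition _ (U V : lmodType k) := GRing.Zmodule.on (tensor U V).

Definition tpure (U V : lmodType k) (u : U) (v : V) : tensor U V := bpure _ _ u v.
Definition tsum (U V : lmodType k) (W : zmodType) (F : U -> V -> W)
  (t : tensor U V) : W := bsum F t.

Definition tbalanced (U V : lmodType k) (W : zmodType) (F : U -> V -> W) : Prop :=
  balanced (fun (u : U) (c : k) => c *: u) (fun (c : k) (v : V) => c *: v) F.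

Lemma tpure_bal (U V : lmodType k) : tbalanced (@tpure U V).
Proof.
split=> [v|u|u c v].
- by apply: zmod_morphism_ofD => u1 u2; exact: bpure_addl.
- by apply: zmod_morphism_ofD => v1 v2; exact: bpure_addr.
- exact: bpure_bal.
Qed.

Section Lift.
Variables (U V : lmodType k) (W : zmodType) (F : U -> V -> W).
Hypothesis Fbal : tbalanced F.

Lemma tsum_additive : zmod_morphism (tsum F).
Proof. exact: bsum_additive. Qed.

Lemma tsum_pure u v : tsum F (tpure u v) = F u v.
Proof. exact: bsum_pure. Qed.
End Lift.

Lemma tensor_ind (U V : lmodType k) (P : tensor U V -> Prop) :
    P 0 -> (forall s t, P s -> P t -> P (s - t)) ->
    (forall u v, P (tpure u v)) -> forall t, P t.
Proof. exact: btensor_ind. Qed.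

Lemma tensor_ext (U V : lmodType k) (W : zmodType) (f g : tensor U V -> W) :
    zmod_morphism f -> zmod_morphism g ->
    (forall u v, f (tpure u v) = g (tpure u v)) -> f =1 g.
Proof.
move=> fB gB fg; apply: tensor_ind => //.
  by rewrite -(subrr 0) fB gB !subrr.
by move=> s t hs ht; rewrite fB gB hs ht.
Qed.

Section Lmodule.
Variables U V : lmodType k.

Definition tscale (c : k) : tensor U V -> tensor U V :=
  tsum (fun u v => tpure (c *: u) v).

Lemma tscale_bal c : tbalanced (fun (u : U) (v : V) => tpure (c *: u) v).
Proof.
have [Hl Hr Hb] := @tpure_bal U V; split=> [v u1 u2|u v1 v2|u s v].
- by rewrite scalerBr Hl.
- exact: Hr.
- by rewrite scalerA mulrC -scalerA Hb.
Qed.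

Lemma tscale_pure c u v : tscale c (tpure u v) = tpure (c *: u) v.
Proof. exact: tsum_pure (tscale_bal c) u v. Qed.

Lemma tscaleB c : zmod_morphism (tscale c).
Proof. exact: tsum_additive (tscale_bal c). Qed.

Lemma tscaleA a b t : tscale a (tscale b t) = tscale (a * b) t.
Proof.
move: t; apply: tensor_ext; [|exact: tscaleB|].
  by move=> s t; rewrite !tscaleB.
by move=> u v; rewrite !tscale_pure scalerA.
Qed.

Lemma tscale1 : left_id 1 tscale.
Proof.
apply: tensor_ext; [exact: tscaleB|by []|].
by move=> u v; rewrite tscale_pure scale1r.
Qed.

Lemma tscaleDr : right_distributive tscale +%R.
Proof. by move=> c; apply: zmod_morphismD; exact: tscaleB. Qed.

Lemma tscaleDl t : {morph tscale^~ t : a b / a + b}.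
Proof.
move=> a b; move: t; apply: tensor_ext; first exact: tscaleB.
  by move=> s t; rewrite !tscaleB opprD addrACA.
have [Hl _ _] := @tpure_bal U V.
by move=> u v; rewrite !tscale_pure scalerDl (zmod_morphismD (Hl v)).
Qed.

HB.instance Definition _ := GRing.Zmodule_isLmodule.Build k (tensor U V)
  tscaleA tscale1 tscaleDr tscaleDl.
End Lmodule.

Section Ring.
Variables U V : algType k.
Implicit Types r s t : tensor U V.

Definition tmul s t : tensor U V :=
  tsum (fun u v => tsum (fun u' v' => tpure (u * u') (v * v')) t) s.

Let inner_bal (u : U) (v : V) :
  tbalanced (fun (u' : U) (v' : V) => tpure (u * u') (v * v')).
Proof.
have [Hl Hr Hb] := @tpure_bal U V; split=> [v' u1 u2|u' v1 v2|u' c v'].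
- by rewrite mulrBr Hl.
- by rewrite mulrBr Hr.
- by rewrite -!scalerAr Hb.
Qed.

Let outer_bal t : tbalanced (fun (u : U) (v : V) =>
  tsum (fun u' v' => tpure (u * u') (v * v')) t).
Proof.
have [Hl Hr Hb] := @tpure_bal U V.
have Hi u v := tsum_additive (inner_bal u v).
split=> [v u1 u2|u v1 v2|u c v]; move: t; apply: tensor_ext;
  do ?[exact: Hi | by apply: zmod_morphism_sub; exact: Hi] => u' v';
  rewrite !(tsum_pure (inner_bal _ _)).
- by rewrite mulrBl Hl.
- by rewrite mulrBl Hr.
- by rewrite -!scalerAl Hb.
Qed.

Lemma tmul_pure u v u' v' :
  tmul (tpure u v) (tpure u' v') = tpure (u * u') (v * v').
Proof. by rewrite /tmul (tsum_pure (outer_bal _)) (tsum_pure (inner_bal _ _)). Qed.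

Lemma tmulBl t : zmod_morphism (tmul^~ t).
Proof. exact: tsum_additive (outer_bal t). Qed.

Lemma tmulBr s : zmod_morphism (tmul s).
Proof.
move=> t1 t2; move: s; apply: tensor_ext; first exact: tmulBl.
  by apply: zmod_morphism_sub; exact: tmulBl.
move=> u v; rewrite /tmul !(tsum_pure (outer_bal _)).
exact: tsum_additive (inner_bal u v) _ _.
Qed.

Lemma tmulA : associative tmul.
Proof.
move=> r s t; move: r; apply: tensor_ext; first exact: tmulBl.
  by move=> r1 r2; rewrite !tmulBl.
move=> u v; move: s; apply: tensor_ext.
- by move=> s1 s2; rewrite tmulBl tmulBr.
- by move=> s1 s2; rewrite tmulBr tmulBl.
move=> u' v'; move: t; apply: tensor_ext.
- by move=> t1 t2; rewrite !tmulBr.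
- exact: tmulBr.
by move=> u'' v''; rewrite !tmul_pure !mulrA.
Qed.

Lemma tmul1 : left_id (tpure 1 1) tmul.
Proof.
apply: tensor_ext => [||u v]; [exact: tmulBr|by []|].
by rewrite tmul_pure !mul1r.
Qed.

Lemma tmulr1 : right_id (tpure 1 1) tmul.
Proof.
apply: tensor_ext => [||u v]; [exact: tmulBl|by []|].
by rewrite tmul_pure !mulr1.
Qed.

Lemma tmulDl : left_distributive tmul +%R.
Proof. by move=> s1 s2 t; exact: (zmod_morphismD (tmulBl t)). Qed.

Lemma tmulDr : right_distributive tmul +%R.
Proof. by move=> s; apply: zmod_morphismD; exact: tmulBr. Qed.

HB.instance Definition _ := GRing.Zmodule_isPzRing.Build (tensor U V)
  tmulA tmul1 tmulr1 tmulDl tmulDr.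
End Ring.
End Tensor.

Notation "u ⊗ v" := (tpure u v) (at level 40, left associativity) : ring_scope.

Section TensorMaps.
Variable k : comNzRingType.

Definition tmap (U V U' V' : lmodType k) (f : U -> U') (g : V -> V') :
    tensor U V -> tensor U' V' := tsum (fun u v => f u ⊗ g v).

Definition tassoc (U V W : lmodType k) :
    tensor (tensor U V) W -> tensor U (tensor V W) :=
  tsum (fun t w => tsum (fun u v => u ⊗ (v ⊗ w)) t).

End TensorMaps.

HB.mixin Record Algebra_isHopf (k : fieldType) H of GRing.Algebra k H := {
  comul : {linear H -> tensor H H};
  counit : {lrmorphism H -> k^o};
  antipode : {linear H -> H};
  comul_monoid_morphism : monoid_morphism comul;
  comulA : forall x, tassoc (tmap comul id (comul x)) = tmap id comul (comul x);
  counit_comull : forall x, tsum (fun x1 x2 => counit x1 *: x2) (comul x) = x;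
  counit_comulr : forall x, tsum (fun x1 x2 => counit x2 *: x1) (comul x) = x;
  antipodel : forall x,
    tsum (fun x1 x2 => antipode x1 * x2) (comul x) = counit x *: 1;
  antipoder : forall x,
    tsum (fun x1 x2 => x1 * antipode x2) (comul x) = counit x *: 1
}.

#[short(type="hopfAlgType")]
HB.structure Definition HopfAlgebra (k : fieldType) :=
  {H of GRing.Algebra k H & Algebra_isHopf k H}.

Section HopfAlgebraTheory.
Variables (k : fieldType) (H : hopfAlgType k).
Implicit Types (I J : set H) (f g : H -> k).

(* The Sweedler sum of F x_(1) x_(2). *)
Definition sweedler (W : zmodType) (F : H -> H -> W) (x : H) : W :=
  tsum F (comul x).

Definition left_ideal I : Prop :=
  submod_closed [in I] /\ forall h x, I x -> I (h * x).

Definition two_sided_ideal I : Prop :=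
  left_ideal I /\ forall h x, I x -> I (x * h).

(* H / I is spanned by finitely many classes. *)
Definition finite_codim I : Prop :=
  exists (n : nat) (b : 'I_n -> H),
    forall x, exists c : 'I_n -> k, I (x - \sum_i c i *: b i).

Definition residually_finite_dim : Prop :=
  forall x : H,
    (forall J, two_sided_ideal J -> finite_codim J -> J x) -> x = 0.

Definition linear_span (V : lmodType k) (G : set V) : set V :=
  smallest (fun X => submod_closed [in X]) G.

(* The span below is I (x) H + H (x) I. *)
Definition coideal I : Prop :=
  [/\ submod_closed [in I],
      forall x, I x ->
        linear_span [set t | exists y z, (I y \/ I z) /\ t = y ⊗ z] (comul x) &
      forall x, I x -> counit x = 0].

Definition coideal_left_ideal I : Prop := coideal I /\ left_ideal I.

Definition biideal I : Prop := coideal I /\ two_sided_ideal I.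

Definition hopf_ideal I : Prop :=
  biideal I /\ forall x, I x -> I (antipode x).

Definition finite_dual : set (H -> k) :=
  [set f | scalar f /\
    exists J, [/\ two_sided_ideal J, finite_codim J &
                  forall x, J x -> f x = 0]].

Definition dual_mul f g : H -> k := sweedler (fun x1 x2 => f x1 * g x2).

(* \sum_i g i (x) h i represents the coproduct of f in finite_dual. *)
Definition dual_comul f (n : nat) (g h : 'I_n -> H -> k) : Prop :=
  [/\ forall i, finite_dual (g i), forall i, finite_dual (h i) &
      forall x y, f (x * y) = \sum_i g i x * h i y].

End HopfAlgebraTheory.
Arguments residually_finite_dim {k} H.
Arguments finite_dual {k} H.

Section Artinian.
Variables (R : nzRingType) (A : set R).

Definition left_artinian : Prop :=
  forall L : nat -> set R,
    (forall n, [/\ L n `<=` A, zmod_closed [in L n] &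
                   forall a x, A a -> L n x -> L n (a * x)]) ->
    (forall n, L n.+1 `<=` L n) ->
  exists n, forall m, (n <= m)%N -> L m = L n.

Definition right_artinian : Prop :=
  forall L : nat -> set R,
    (forall n, [/\ L n `<=` A, zmod_closed [in L n] &
                   forall a x, A a -> L n x -> L n (x * a)]) ->
    (forall n, L n.+1 `<=` L n) ->
  exists n, forall m, (n <= m)%N -> L m = L n.

End Artinian.

(* R (x)_A R for a subring A of R. *)
Definition tensor_over (R : nzRingType) (A : set R) : Type :=
  btensor (fun (x : R) (a : {a | A a}) => x * sval a)
          (fun (a : {a | A a}) (y : R) => sval a * y).
HB.instance Definition _ (R : nzRingType) (A : set R) :=
  GRing.Zmodule.on (tensor_over A).

Definition opure (R : nzRingType) (A : set R) (x y : R) : tensor_over A :=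
  bpure _ _ x y.

Section QuotientRing.
Variables (k : fieldType) (H : hopfAlgType k) (Q : unitAlgType k).
Variable iota : {lrmorphism H -> Q}.

Definition nonzerodivisor (s : H) : Prop := GRing.lreg s /\ GRing.rreg s.

Definition artinian_quotient_ring : Prop :=
  [/\ injective iota,
      left_artinian [set: Q] /\ right_artinian [set: Q],
      forall s, nonzerodivisor s -> iota s \is a GRing.unit,
      forall q, exists a s, nonzerodivisor s /\ q = iota a / iota s &
      forall q, exists b t, nonzerodivisor t /\ q = (iota t)^-1 * iota b].

Variable act : (H -> k) -> Q -> Q.

(* [act] (only relevant on finite_dual H) is a left module algebra structure
   which extends the action of f in finite_dual H on x in H by
   \sum f(x_(2)) x_(1). *)
Record extended_action : Prop := ExtendedAction {
  act_iota : forall f x, finite_dual H f ->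
    act f (iota x) = iota (sweedler (fun x1 x2 => f x2 *: x1) x);
  act_linear : forall f, finite_dual H f -> linear (act f);
  act_linear_dual : forall (c : k) f g q,
    finite_dual H f -> finite_dual H g ->
    act (fun x => c * f x + g x) q = c *: act f q + act g q;
  act_counit : forall q, act counit q = q;
  act_dual_mul : forall f g q, finite_dual H f -> finite_dual H g ->
    act (dual_mul f g) q = act f (act g q);
  act_one : forall f, finite_dual H f -> act f 1 = f 1 *: 1;
  act_mul : forall f n (g h : 'I_n -> H -> k) p q,
    finite_dual H f -> dual_comul f g h ->
    act f (p * q) = \sum_i act (g i) p * act (h i) q
}.

Definition invariant_artinian_subalgebra (A : set Q) : Prop :=
  [/\ subalg_closed [in A],
      left_artinian A, right_artinian A &
      forall f q, finite_dual H f -> A q -> A (act f q)].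

Definition subbimodule (N : set (tensor Q Q)) : Prop :=
  zmod_closed [in N] /\
  forall p q t, N t -> N (tmap (fun x => p * x) (fun y => y * q) t).

Definition generated_subbimodule (I : set H) : set (tensor Q Q) :=
  smallest subbimodule
    [set sweedler (fun x1 x2 => iota x1 ⊗ iota (antipode x2)) x | x in I].

(* I and A correspond to each other under the bijection between coideal left
   ideals and invariant artinian subalgebras. *)
Definition corresponding (I : set H) (A : set Q) : Prop :=
  I = [set x | sweedler (fun x1 x2 =>
                 opure A (iota x1) (iota (antipode x2))) x = 0] /\
  A = [set q | generated_subbimodule I (1 ⊗ q - q ⊗ 1)].

Definition right_adjoint (q : Q) (h : H) : Q :=
  sweedler (fun h1 h2 => iota (antipode h1) * q * iota h2) h.

Definition right_adjoint_stable (A : set Q) : Prop :=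
  forall q h, A q -> A (right_adjoint q h).

End QuotientRing.

(* Main.v *)
(* Write [a <| h] for the right adjoint action and [K] for the kernel of
   [Q (x) Q -> Q (x)_A Q], so that [x] is in [I] iff [x_(1) (x) S(x_(2))] is in
   [K].

   The maps [p (x) q |-> p h_(1) (x) S(h_(2)) q] send [x_(1) (x) S(x_(2))] to the
   corresponding element for [x h]. They preserve the subbimodule defining [A]
   when [I] is a right ideal, and they preserve [K] when [A] is stable under
   [<|]. Hence [I] is two-sided iff [A] is stable under [<|].

   Let now [I] be two-sided. As [A] is [H°]-invariant, the set of the [z] in
   [H (x) H] whose image under [x (x) y |-> x_(1) (x) S(x_(2)) y] lies in [K] is
   stable under the action of [H°] on the second factor; as [H] is residually
   finite-dimensional, it is a Hopf module, hence equal to [I (x) H]. Clearing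
   denominators, this shows that [a_(1) (x) a_(2) = 1 (x) a] modulo [I (x) Q]
   for [a] in [A], in the sense that [t_(1) (x) a t_(2) = g_(1) (x) g_(2)] when
   [a t = g] with [t, g] in [H]. Multiplying by the antipode gives
   [S(a_(1)) (x) a_(2) = 1 (x) a] in the same sense, so that
   [p (x) q |-> S(p_(1)) (x) p_(2) q] vanishes on [K] modulo [I (x) Q] up to
   denominators. At [x_(1) (x) S(x_(2))] its value is [S(x) (x) 1]. *)

From HB Require Import structures.
Require Import Defs.
From mathcomp Require Import all_boot all_algebra.
From mathcomp Require Import boolp classical_sets.
From mathcomp Require Import freeg.

Set Implicit Arguments.
Unset Strict Implicit.
Unset Printing Implicit Defensive.

Import GRing.Theory.
Local Open Scope classical_set_scope.
Local Open Scope ring_scope.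

(** * Multilinear maps and linear maps out of tensor products *)

Section Linearity.
Variable k : comNzRingType.
Implicit Types U V W : lmodType k.

Definition bilinear2 U V W (F : U -> V -> W) : Prop :=
  (forall v, linear (fun u => F u v)) /\ (forall u, linear (F u)).

Definition trilinear U V V' W (F : U -> V -> V' -> W) : Prop :=
  [/\ forall v w, linear (fun u => F u v w),
      forall u w, linear (fun v => F u v w) &
      forall u v, linear (fun w => F u v w)].

Lemma linear_idfun U : linear (fun u : U => u).
Proof. by []. Qed.

Lemma linear_comp U V W (g : V -> W) (f : U -> V) :
  linear g -> linear f -> linear (fun u => g (f u)).
Proof. by move=> gL fL c u v; rewrite fL gL. Qed.

Lemma linear_mull U (R : algType k) (f : U -> R) r :
  linear f -> linear (fun u => f u * r).
Proof. by move=> fL c u v; rewrite fL mulrDl scalerAl. Qed.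

Lemma linear_mulr U (R : algType k) (f : U -> R) r :
  linear f -> linear (fun u => r * f u).
Proof. by move=> fL c u v; rewrite fL mulrDr scalerAr. Qed.

Lemma linear_scalel U W (f : U -> k^o) (w : W) :
  linear f -> linear (fun u => (f u : k) *: w).
Proof. by move=> fL c u v; rewrite fL scalerDl scalerA. Qed.

Lemma linear_scaler U W (f : U -> W) (c : k) :
  linear f -> linear (fun u => c *: f u).
Proof. by move=> fL d u v; rewrite fL scalerDr !scalerA mulrC. Qed.

Lemma linear_sub U W (f g : U -> W) :
  linear f -> linear g -> linear (fun u => f u - g u).
Proof. by move=> fL gL c u v; rewrite fL gL scalerBr opprD addrACA. Qed.

Lemma bilinear2_balanced U V W (F : U -> V -> W) : bilinear2 F -> tbalanced F.
Proof.
move=> [Fl Fr]; split=> [v|u|u c v].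
- exact: (zmod_morphism_linear (Fl v)).
- exact: (zmod_morphism_linear (Fr u)).
- by rewrite (scalable_linear (Fl v)) (scalable_linear (Fr u)).
Qed.

Lemma tpure_bilinear U V : bilinear2 (@tpure k U V).
Proof.
have [Hl Hr Hb] := @tpure_bal k U V.
have HZ c (u : U) (v : V) : (c *: u) ⊗ v = c *: (u ⊗ v) by symmetry; exact: tscale_pure.
split=> [v c u u'|u c v v'].
  by rewrite (zmod_morphismD (Hl v)) HZ.
by rewrite (zmod_morphismD (Hr u)) -Hb HZ.
Qed.

Lemma tpureZl U V c (u : U) (v : V) : (c *: u) ⊗ v = c *: (u ⊗ v).
Proof. exact: (scalable_linear ((tpure_bilinear U V).1 v)). Qed.

Lemma tpureZr U V c (u : U) (v : V) : u ⊗ (c *: v) = c *: (u ⊗ v).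
Proof. exact: (scalable_linear ((tpure_bilinear U V).2 u)). Qed.

Lemma tpureDl U V (u u' : U) (v : V) : (u + u') ⊗ v = u ⊗ v + u' ⊗ v.
Proof. exact: (zmod_morphismD (zmod_morphism_linear ((tpure_bilinear U V).1 v))). Qed.

Lemma tpure0l U V (v : V) : (0 : U) ⊗ v = 0.
Proof. by rewrite -(scale0r (0 : U)) tpureZl scale0r. Qed.

Lemma tpure0r U V (u : U) : u ⊗ (0 : V) = 0.
Proof. by rewrite -(scale0r (0 : V)) tpureZr scale0r. Qed.

Lemma tpureBr U V (u : U) (v v' : V) : u ⊗ (v - v') = u ⊗ v - u ⊗ v'.
Proof. exact: (zmod_morphism_linear ((tpure_bilinear U V).2 u)). Qed.

Lemma linear_tpurel U V V' (f : U -> V) (v : V') :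
  linear f -> linear (fun u => f u ⊗ v).
Proof. exact: linear_comp ((tpure_bilinear _ _).1 v). Qed.

Lemma linear_tpurer U V V' (f : U -> V') (v : V) :
  linear f -> linear (fun u => v ⊗ f u).
Proof. exact: linear_comp ((tpure_bilinear _ _).2 v). Qed.

Lemma tensor_linear_ext U V W (f g : tensor U V -> W) :
  linear f -> linear g -> (forall u v, f (u ⊗ v) = g (u ⊗ v)) -> f =1 g.
Proof.
by move=> /(@zmod_morphism_linear _ _ _ _ _) fB /(@zmod_morphism_linear _ _ _ _ _) gB;
  exact: tensor_ext.
Qed.

Lemma tsum_bilinear U V W (F : U -> V -> W) u v :
  bilinear2 F -> tsum F (u ⊗ v) = F u v.
Proof. by move=> /bilinear2_balanced hF; exact: tsum_pure. Qed.

(** Balancedness only yields additivity; compatibility with scalars is then checked on pure tensors,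
    where the scalar can be put on the first factor. *)
Lemma tsum_linear U V W (F : U -> V -> W) : bilinear2 F -> linear (tsum F).
Proof.
move=> FL; have FB := tsum_additive (bilinear2_balanced FL).
move=> c s t; rewrite (zmod_morphismD FB); congr (_ + _); move: s.
apply: tensor_ext => [x y|x y|u v] /=; rewrite ?scalerBr ?FB ?scalerBr //.
have -> : c *: (u ⊗ v) = (c *: u) ⊗ v.
  by rewrite (scalable_linear ((tpure_bilinear U V).1 v)).
by rewrite !tsum_bilinear // (scalable_linear (FL.1 v)).
Qed.

Lemma linear_tsum U U' V W (F : U -> V -> W) (f : U' -> tensor U V) :
  bilinear2 F -> linear f -> linear (fun u => tsum F (f u)).
Proof. by move=> /tsum_linear; exact: linear_comp. Qed.

(** Complements [linear_tsum]: here the variable occurs in the map and not in the tensor. *)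
Lemma linear_tsum_fun U U' V W (F : U' -> U -> V -> W) t :
  (forall x, bilinear2 (F x)) -> (forall u v, linear (fun x => F x u v)) ->
  linear (fun x => tsum (F x) t).
Proof.
move=> F2 FL c x y.
have GB z := tsum_additive (bilinear2_balanced (F2 z)).
move: t; apply: tensor_ext => [s t|s t|u v] /=.
- by rewrite GB.
- by rewrite !GB scalerBr opprD addrACA.
- by rewrite !tsum_bilinear // FL.
Qed.

Lemma tmap_bilinear U V U' V' (f : U -> U') (g : V -> V') :
  linear f -> linear g -> bilinear2 (fun u v => f u ⊗ g v).
Proof.
by move=> fL gL; split=> w; [exact: linear_tpurel | exact: linear_tpurer].
Qed.

Lemma tmap_linear U V U' V' (f : U -> U') (g : V -> V') :
  linear f -> linear g -> linear (tmap f g).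
Proof. by move=> fL gL; exact/tsum_linear/tmap_bilinear. Qed.

Lemma tmap_pure U V U' V' (f : U -> U') (g : V -> V') u v :
  linear f -> linear g -> tmap f g (u ⊗ v) = f u ⊗ g v.
Proof. by move=> fL gL; exact/tsum_bilinear/tmap_bilinear. Qed.

End Linearity.

(* [linear_comp] along the identity would loop. *)
Ltac not_identity f := lazymatch f with (fun x => x) => fail | _ => idtac end.

(** Recursion on the expression: each construction is peeled off after deciding which of its
    arguments carries the variable. Atoms are closed by hypotheses or by [linearP]. *)
Ltac linearity := intros; cbv beta; lazymatch goal with
 | |- bilinear2 _ => first [assumption | split; linearity]
 | |- trilinear _ => first [assumption | split; linearity]
 | |- GRing.linear_for _ (fun x => x) => exact: linear_idfun
 | |- GRing.linear_for _ (fun x => @GRing.add _ (@?f x) (GRing.opp (@?g x))) =>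
     apply: (linear_sub (f := f) (g := g)); linearity
 | |- GRing.linear_for _ (fun x => GRing.mul (@?f x) (@?g x)) =>
     first [apply: (linear_mull (f := f)) | apply: (linear_mulr (f := g))];
     linearity
 | |- GRing.linear_for _ (fun x => GRing.scale (@?f x) (@?g x)) =>
     first [apply: (linear_scalel (f := f)) | apply: (linear_scaler (f := g))];
     linearity
 | |- GRing.linear_for _ (fun x => tpure (@?f x) (@?g x)) =>
     first [apply: (linear_tpurel (f := f)) | apply: (linear_tpurer (f := g))];
     linearity
 | |- GRing.linear_for _ (fun x => tsum (@?F x) (@?f x)) =>
     first [apply: (linear_tsum (f := f)) | apply: (linear_tsum_fun (F := F))];
     linearity
 | |- GRing.linear_for _ (fun x => sweedler (@?F x) (@?f x)) =>
     rewrite /sweedler; linearity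
 | |- GRing.linear_for _ (tpure _) => exact: (tpure_bilinear _ _).2
 | |- GRing.linear_for _ (tsum _) => apply: tsum_linear; linearity
 | |- GRing.linear_for _ (sweedler _) =>
     apply: linear_tsum; [linearity | exact: linearP]
 | |- _ => first
     [ assumption | exact: linearP
     | solve [match goal with
             | H : context [GRing.linear_for] |- _ => apply H
             | H : context [bilinear2] |- _ => apply H
             | H : context [trilinear] |- _ => apply H
             end]
     | lazymatch goal with |- GRing.linear_for _ (fun x => ?g (@?f x)) =>
         not_identity f; apply: (linear_comp (g := g) (f := f)) end; linearity
     | lazymatch goal with |- GRing.linear_for _ (fun x => ?g (@?f x) ?c) =>
         not_identity f; apply: (linear_comp (g := fun y => g y c) (f := f))
       end; linearity
     | lazymatch goal with |- GRing.linear_for _ (fun x => ?g (@?f x) ?c ?d) =>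
         not_identity f; apply: (linear_comp (g := fun y => g y c d) (f := f))
       end; linearity
     ]
 end.

(** * Sweedler calculus in a Hopf algebra *)

Section Sweedler.
Variables (k : fieldType) (H : hopfAlgType k).
Implicit Types (W : lmodType k) (x y : H).

Lemma sweedler_linear W (F : H -> H -> W) : bilinear2 F -> linear (sweedler F).
Proof. by move=> FL; exact: linear_tsum FL (linearP _). Qed.

Lemma eq_sweedler (W : zmodType) (F G : H -> H -> W) x :
  (forall a b, F a b = G a b) -> sweedler F x = sweedler G x.
Proof. by move=> FG; congr sweedler; apply/funext => a; apply/funext => b. Qed.

Lemma linear_sweedler W W' (g : W -> W') (F : H -> H -> W) x :
  linear g -> bilinear2 F ->
  g (sweedler F x) = sweedler (fun a b => g (F a b)) x.
Proof.
move=> gL FL; rewrite /sweedler; move: (comul x).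
by apply: tensor_linear_ext => [||u v]; rewrite ?tsum_bilinear //; linearity.
Qed.

(** The map [L] is the linear map on [H ⊗ (H ⊗ H)] induced by [G]; the two sides are its values at
    the two iterated coproducts, which [comulA] identifies. *)
Lemma sweedler_coassoc W (G : H -> H -> H -> W) x : trilinear G ->
  sweedler (fun a c => sweedler (fun a1 a2 => G a1 a2 c) a) x =
  sweedler (fun a b => sweedler (fun b1 b2 => G a b1 b2) b) x.
Proof.
move=> GL.
pose L (t : tensor H (tensor H H)) := tsum (fun a s => tsum (G a) s) t.
have G2 a : bilinear2 (G a) by case: GL => ? ? ?; split.
have G2' c : bilinear2 (fun a b => G a b c) by case: GL => ? ? ?; split.
have LL : bilinear2 (fun a s => tsum (G a) s) by case: (GL) => ? ? ?; linearity.
have AL : bilinear2 (fun (t : tensor H H) c =>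
    tsum (fun u v : H => u ⊗ (v ⊗ c)) t) by linearity.
rewrite /sweedler; transitivity (L (tassoc (tmap comul id (comul x)))).
  rewrite /L /tassoc /tmap; move: (comul x).
  apply: tensor_linear_ext => [||u v]; [by linearity|by linearity|].
  rewrite !tsum_bilinear //; try by linearity.
  move: (comul u).
  by apply: tensor_linear_ext => [||u' v']; rewrite ?tsum_bilinear //; linearity.
rewrite comulA /L /tmap; move: (comul x).
by apply: tensor_linear_ext => [||u v]; rewrite ?tsum_bilinear //; linearity.
Qed.

Lemma sweedler_counitl W (f : H -> W) x : linear f ->
  sweedler (fun a b => (counit a : k) *: f b) x = f x.
Proof.
move=> fL; rewrite -[in RHS](counit_comull x) (@linear_sweedler _ _ f) //; last by linearity.
by apply: eq_sweedler => a b; rewrite (scalable_linear fL).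
Qed.

Lemma sweedler_counitr W (f : H -> W) x : linear f ->
  sweedler (fun a b => (counit b : k) *: f a) x = f x.
Proof.
move=> fL; rewrite -[in RHS](counit_comulr x) (@linear_sweedler _ _ f) //; last by linearity.
by apply: eq_sweedler => a b; rewrite (scalable_linear fL).
Qed.

Lemma sweedler_antipodel W (f : H -> W) x : linear f ->
  sweedler (fun a b => f (antipode a * b)) x = (counit x : k) *: f 1.
Proof.
move=> fL; rewrite -(@linear_sweedler _ _ f) //; last by linearity.
by rewrite {1}/sweedler antipodel (scalable_linear fL).
Qed.

Lemma sweedler_antipoder W (f : H -> W) x : linear f ->
  sweedler (fun a b => f (a * antipode b)) x = (counit x : k) *: f 1.
Proof.
move=> fL; rewrite -(@linear_sweedler _ _ f) //; last by linearity.
by rewrite {1}/sweedler antipoder (scalable_linear fL).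
Qed.

Lemma sweedlerM W (F : H -> H -> W) x y : bilinear2 F ->
  sweedler F (x * y) =
  sweedler (fun a b => sweedler (fun c d => F (a * c) (b * d)) y) x.
Proof.
move=> FL; rewrite /sweedler (@comul_monoid_morphism k H).2.
rewrite -[_ * _]/(tsum (fun u v => tsum (fun u' v' => (u * u') ⊗ (v * v'))
  (comul y)) (comul x)).
move: (comul x) (comul y) => s t; move: s.
apply: tensor_linear_ext => [||u v]; [by linearity|by linearity|].
rewrite !tsum_bilinear //; try by linearity.
move: t; apply: tensor_linear_ext => [||u' v']; [by linearity|by linearity|].
by rewrite !tsum_bilinear //; linearity.
Qed.

Lemma sweedler1 W (F : H -> H -> W) : bilinear2 F -> sweedler F 1 = F 1 1.
Proof.
by move=> FL; rewrite /sweedler (@comul_monoid_morphism k H).1 tsum_bilinear.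
Qed.

Lemma trilinear_bilinear2 W (G : H -> H -> H -> W) x :
  trilinear G -> bilinear2 (G x).
Proof. by case=> ? ? ?; split. Qed.

Lemma trilinear_sweedler W (G : H -> H -> H -> W) :
  trilinear G -> bilinear2 (fun x => sweedler (G x)).
Proof.
move=> GL; split=> x; last first.
  exact: sweedler_linear (trilinear_bilinear2 _ GL).
apply: linear_tsum_fun => [y|u v]; first exact: trilinear_bilinear2.
by case: GL.
Qed.

Lemma sweedlerB W (F G : H -> H -> W) x : bilinear2 F -> bilinear2 G ->
  sweedler (fun a b => F a b - G a b) x = sweedler F x - sweedler G x.
Proof.
move=> FL GL; rewrite /sweedler; move: (comul x).
by apply: tensor_linear_ext => [||u v]; rewrite ?tsum_bilinear //; linearity.
Qed.

Lemma sweedler_sum W m (F : 'I_m -> H -> H -> W) x :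
  (forall l, bilinear2 (F l)) ->
  sweedler (fun a b => \sum_l F l a b) x = \sum_l sweedler (F l) x.
Proof.
move=> FL.
have SL (U V : lmodType k) (f : 'I_m -> U -> V) :
    (forall l, linear (f l)) -> linear (fun u => \sum_l f l u).
  move=> fL c u v; rewrite scaler_sumr -big_split.
  by apply: eq_bigr => l _; exact: fL.
have SL2 : bilinear2 (fun a b => \sum_l F l a b).
  by split=> a; apply: SL => l; case: (FL l).
rewrite /sweedler; move: (comul x); apply: tensor_linear_ext => [||u v].
- exact: tsum_linear.
- by apply: SL => l; exact: tsum_linear.
- by rewrite tsum_bilinear //; apply: eq_bigr => l _; rewrite tsum_bilinear.
Qed.

Lemma exchange_sweedler W (F : H -> H -> H -> H -> W) x y :
  (forall a b, bilinear2 (F a b)) -> (forall c d, bilinear2 (fun a b => F a b c d)) ->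
  sweedler (fun a b => sweedler (F a b) y) x =
  sweedler (fun c d => sweedler (fun a b => F a b c d) x) y.
Proof.
move=> FL FL'; rewrite /sweedler; move: (comul x) (comul y) => s t.
have L1 (a : H) : linear (fun c : H => tsum (F a c) t).
  by apply: linear_tsum_fun => // u v; case: (FL' u v) => ? /(_ a).
have L2 (a : H) : linear (fun c : H => tsum (F c a) t).
  by apply: linear_tsum_fun => // u v; case: (FL' u v) => /(_ a).
have L3 (a : H) : linear (fun c : H => tsum (fun u v => F u v a c) s).
  by apply: linear_tsum_fun => // u v; case: (FL u v) => ? /(_ a).
have L4 (a : H) : linear (fun c : H => tsum (fun u v => F u v c a) s).
  by apply: linear_tsum_fun => // u v; case: (FL u v) => /(_ a).
have LL : linear (fun s => tsum (fun c d => tsum (fun a b => F a b c d) s) t).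
  apply: linear_tsum_fun => [x'|u v]; last by linearity.
  split=> a; apply: linear_tsum_fun => // u v; case: (FL u v).
    by move=> + _; apply.
  by move=> _; apply.
move: {L3 L4} s; apply: tensor_linear_ext => [||u v] //.
  by apply: tsum_linear; split.
rewrite tsum_bilinear; last by split.
rewrite /tsum; congr bsum; apply/funext => c; apply/funext => d.
by rewrite [RHS]tsum_bilinear.
Qed.

(** Coassociativity makes [a] and [c] the two halves of one leg, the antipode axiom turns that leg
    into a counit, and the other leg absorbs it. This lemma and its three variants are mostly
    applied from right to left, to insert a cancelling pair. *)
Lemma sweedler_mul_antipode_l W (G : H -> H -> W) x : bilinear2 G ->
  sweedler (fun a b => sweedler (fun c d => G (a * antipode c) d) b) x = G 1 x.
Proof.
move=> GL; rewrite -(@sweedler_coassoc _ (fun a c d => G (a * antipode c) d));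
  last by linearity.
rewrite -(@sweedler_counitl _ (G 1)); last by linearity.
apply: eq_sweedler => a b; rewrite (@sweedler_antipoder _ (fun y => G y b)) //.
by linearity.
Qed.

Lemma sweedler_antipode_mul_l W (G : H -> H -> W) x : bilinear2 G ->
  sweedler (fun a b => sweedler (fun c d => G (antipode a * c) d) b) x = G 1 x.
Proof.
move=> GL; rewrite -(@sweedler_coassoc _ (fun a c d => G (antipode a * c) d));
  last by linearity.
rewrite -(@sweedler_counitl _ (G 1)); last by linearity.
apply: eq_sweedler => a b; rewrite (@sweedler_antipodel _ (fun y => G y b)) //.
by linearity.
Qed.

Lemma sweedler_mul_antipode_r W (G : H -> H -> W) x : bilinear2 G ->
  sweedler (fun a b => sweedler (fun c d => G a (c * antipode d)) b) x = G x 1.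
Proof.
move=> GL; rewrite -(@sweedler_counitr _ (fun y => G y 1)); last by linearity.
apply: eq_sweedler => a b; rewrite (@sweedler_antipoder _ (G a)) //.
by linearity.
Qed.

Lemma sweedler_antipode_mul_r W (G : H -> H -> W) x : bilinear2 G ->
  sweedler (fun a b => sweedler (fun c d => G a (antipode c * d)) b) x = G x 1.
Proof.
move=> GL; rewrite -(@sweedler_counitr _ (fun y => G y 1)); last by linearity.
apply: eq_sweedler => a b; rewrite (@sweedler_antipodel _ (G a)) //.
by linearity.
Qed.

(* The sum of [S(x1 y1) (x2 y2) (S(y3) S(x3))] collapses to [S(xy)] from the
   right and to [S(y) S(x)] from the left. *)
Lemma antipodeM x y : antipode (x * y) = antipode y * antipode x.
Proof.
pose E := sweedler (fun a b => sweedler (fun c d =>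
  sweedler (fun e f => sweedler (fun g h =>
   antipode (a * e) * (c * g) * (antipode h * antipode d)) f) y) b) x.
transitivity E.
  rewrite -[LHS]mulr1.
  rewrite -(@sweedler_mul_antipode_r _ (fun a m => antipode (a * y) * m) x); last by linearity.
  apply: eq_sweedler => a b; apply: eq_sweedler => c d.
  transitivity ((fun e m => antipode (a * e) * c * m * antipode d) y 1).
    by rewrite /= mulr1 !mulrA.
  rewrite -(@sweedler_mul_antipode_r _ (fun e m => antipode (a * e) * c * m * antipode d));
    last by linearity.
  by apply: eq_sweedler => e f; apply: eq_sweedler => g h; rewrite !mulrA.
rewrite /E -(@sweedler_coassoc _ (fun a c d => sweedler (fun e f => sweedler (fun g h =>
   antipode (a * e) * (c * g) * (antipode h * antipode d)) f) y)); last by linearity.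
rewrite -(@sweedler_counitl _ (fun d => antipode y * antipode d)); last by linearity.
apply: eq_sweedler => m d.
(* Coassociativity in [y] isolates a leg [p] such that, by [sweedlerM], the inner sums form the
   coproduct of [m * p]; [antipodel] reduces them to [counit (m * p)]. *)
transitivity (sweedler (fun p h => (counit (m * p) : k) *: (antipode h * antipode d)) y).
  rewrite -[RHS](@eq_sweedler _ (fun p h => sweedler (fun a c => sweedler (fun e g =>
     antipode (a * e) * (c * g) * (antipode h * antipode d)) p) m)).
    rewrite -(@exchange_sweedler _ (fun a c p h => sweedler (fun e g =>
      antipode (a * e) * (c * g) * (antipode h * antipode d)) p)); try by linearity.
    apply: eq_sweedler => a c.
    rewrite (@sweedler_coassoc _ (fun e g h =>
       antipode (a * e) * (c * g) * (antipode h * antipode d))) //.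
    by linearity.
  move=> p h; rewrite -(@sweedlerM _ (fun u v => antipode u * v * (antipode h * antipode d)));
    last by linearity.
  rewrite (@sweedler_antipodel _ (fun u => u * (antipode h * antipode d))) ?mul1r //.
  by linearity.
rewrite -(@sweedler_counitl _ (fun h => antipode h * antipode d)); last by linearity.
rewrite (@linear_sweedler _ _ (fun u => (counit m : k) *: u)); try by linearity.
by apply: eq_sweedler => p h; rewrite rmorphM scalerA.
Qed.

End Sweedler.


(** * Linear algebra: retractions, subspaces and additive subgroups *)

Lemma linear_retraction (k : fieldType) (U V : lmodType k) (f : {linear U -> V}) :
  injective f -> exists r : {linear V -> U}, cancel f r.
Proof.
move=> f_inj.
(* Zorn's lemma is applied to the subspaces meeting the image of [f] trivially; a maximal one is a
   complement. Membership of [0] is not imposed because the union of the empty chain is empty; [W0]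
   adds it afterwards. *)
pose P := [set W : set V | (forall c w w', W w -> W w' -> W (c *: w + w')) /\
                           (forall u, W (f u) -> u = 0)].
have [|W [[WL Wf] Wmax]] := @Zorn_bigcup V P.
  move=> F FP Ftot; split=> [c w w' [X FX Xw] [Y FY Yw']|u [X FX /(FP _ FX).2//]].
  have [XY|YX] := Ftot _ _ FX FY.
    by exists Y => //; apply: (FP _ FY).1 => //; exact: XY.
  by exists X => //; apply: (FP _ FX).1 => //; exact: YX.
pose W0 : set V := [set w | W w \/ w = 0].
have W0L c w w' : W0 w -> W0 w' -> W0 (c *: w + w').
  move=> [Ww|->] [Ww'|->]; rewrite ?scaler0 ?add0r;
    [|case: (pselect (W 0)) => W0'| |]; rewrite /W0 /=.
  - by left; exact: WL.
  - by left; exact: WL.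
  - left; have := WL (- 1 + c) w w Ww Ww.
    by rewrite scalerDl scaleN1r addrC addrA addrN add0r addr0.
  - by left.
  - by right.
have W0f u : W0 (f u) -> u = 0.
  by move=> [/Wf//|fu0]; apply: f_inj; rewrite fu0 linear0.
have dec v : exists u, W0 (v - f u).
  (* If [v] were outside [W0] plus the image, then the span [B] of [v] and [W0] would still meet the
     image trivially, against maximality. *)
  apply: contrapT => nv; pose B := [set w | exists c w', W0 w' /\ w = c *: v + w'].
  apply: (Wmax B).
    split; first by move=> w Ww; exists 0, w; rewrite scale0r add0r; split=> //; left.
    move=> /(_ v) Bv; apply: nv; exists 0; rewrite linear0 subr0; left; apply: Bv.
    by exists 1, 0; rewrite scale1r addr0; split=> //; right.
  split=> [c w w' [a [x [Wx ->]]] [b [y [Wy ->]]]|u [c [w [Ww fu]]]].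
    exists (c * a + b), (c *: x + y); split; first exact: W0L.
    by rewrite scalerDr scalerDl !scalerA addrACA.
  have [c0|c0] := eqVneq c 0; first by apply: W0f; rewrite fu c0 scale0r add0r.
  case: nv; exists (c^-1 *: u); rewrite linearZ /= fu scalerDr scalerA mulVf // scale1r.
  rewrite opprD addrA subrr add0r -scaleNr -[X in W0 X]addr0.
  by apply: W0L => //; right.
have [r rP] := choice dec.
have rE v u : W0 (v - f u) -> r v = u.
  move=> vu; apply/eqP; rewrite -subr_eq0; apply/eqP/W0f; rewrite linearB /=.
  have -> : f (r v) - f u = -1 *: (v - f (r v)) + (v - f u).
    by rewrite scaleN1r opprB addrA subrK.
  exact: W0L.
have rL : linear r.
  move=> c u v; apply: rE; rewrite linearP /=.
  have -> : c *: u + v - (c *: f (r u) + f (r v)) = c *: (u - f (r u)) + (v - f (r v)).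
    by rewrite scalerBr opprD addrACA.
  exact: W0L.
pose rLin := GRing.isLinear.Build k V U *:%R r rL.
pose r' : {linear V -> U} := HB.pack r rLin.
by exists r' => u; apply: rE; rewrite subrr; right.
Qed.

Lemma submod_closedP (k : comNzRingType) (V : lmodType k) (N : set V) :
  submod_closed [in N] <->
  N 0 /\ (forall c u v, N u -> N v -> N (c *: u + v)).
Proof.
split=> [[N0 NP]|[N0 NP]]; split.
- by move: N0; rewrite inE.
- by move=> c u v Nu Nv; have := NP c u v; rewrite !inE; apply.
- by rewrite inE.
- by move=> c u v; rewrite !inE; exact: NP.
Qed.

Lemma zmod_closedP (V : zmodType) (N : set V) :
  zmod_closed [in N] <-> N 0 /\ (forall u v, N u -> N v -> N (u - v)).
Proof.
split=> [[N0 NB]|[N0 NB]]; split.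
- by move: N0; rewrite inE.
- by move=> u v Nu Nv; have := NB u v; rewrite !inE; apply.
- by rewrite inE.
- by move=> u v; rewrite !inE; exact: NB.
Qed.

Lemma zmod_closed_set_add (V : zmodType) (N : set V) u v :
  zmod_closed [in N] -> N u -> N v -> N (u + v).
Proof.
move=> /zmod_closedP[N0 NB] Nu Nv; rewrite -[v]opprK; apply: (NB) => //.
by rewrite -sub0r; exact: NB.
Qed.

Lemma submod_closed_zmod (k : comNzRingType) (V : lmodType k) (N : set V) :
  submod_closed [in N] -> zmod_closed [in N].
Proof.
move=> /submod_closedP[N0 NP]; apply/zmod_closedP; split=> // u v Nu Nv.
by rewrite addrC -scaleN1r; exact: NP.
Qed.

Lemma zmod_morphism0 (U V : zmodType) (f : U -> V) : zmod_morphism f -> f 0 = 0.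
Proof. by move=> fB; rewrite -(subrr 0) fB subrr. Qed.

Lemma tensor_set_ind (k : comNzRingType) (U V : lmodType k) (W : zmodType)
    (N : set W) (f : tensor U V -> W) :
  zmod_closed [in N] -> zmod_morphism f -> (forall u v, N (f (u ⊗ v))) ->
  forall t, N (f t).
Proof.
move=> /zmod_closedP[N0 NB] fB fN; apply: tensor_ind => [|s t Ns Nt|//].
  by rewrite -(subrr 0) fB subrr.
by rewrite fB; exact: NB.
Qed.

Lemma linear_span_closed (k : fieldType) (V : lmodType k) (G : set V) :
  submod_closed [in linear_span G].
Proof.
apply/submod_closedP; split=> [N [/submod_closedP[]]//|c u v Gu Gv N [NP GN]].
by case/submod_closedP: (NP) => _; apply; [apply: Gu|apply: Gv].
Qed.

(** * The subspace [I ⊗ V] of [U ⊗ V] *)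

Section Subtensor.
Variables (k : fieldType) (U : lmodType k) (I : set U).
Implicit Types V W : lmodType k.

Definition subtensor V : set (tensor U V) :=
  linear_span [set t | exists x v, I x /\ t = x ⊗ v].

Lemma subtensor_closed V : submod_closed [in @subtensor V].
Proof. exact: linear_span_closed. Qed.

Lemma subtensor_pure V x (v : V) : I x -> subtensor (x ⊗ v).
Proof. by move=> Ix; apply: sub_gen_smallest; exists x, v. Qed.

Lemma subtensor_tsum V W (N : set W) (F : U -> V -> W) t :
  submod_closed [in N] -> bilinear2 F -> (forall x v, I x -> N (F x v)) ->
  subtensor t -> N (tsum F t).
Proof.
move=> /submod_closedP[N0 NP] FL FN.
have TL := tsum_linear FL.
pose X := [set t | N (tsum F t)]; apply: (@smallest_sub _ _ _ X) => [|_ [x [v [Ix ->]]]].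
  apply/submod_closedP; split=> [|c s s' Xs Xs']; rewrite /X /=.
    by rewrite (zmod_morphism0 (zmod_morphism_linear TL)).
  by rewrite TL; exact: NP.
by rewrite /X /= tsum_bilinear //; exact: FN.
Qed.

Lemma tensor_sum V (w : tensor U V) :
  exists s : seq (U * V), w = \sum_(p <- s) p.1 ⊗ p.2.
Proof.
move: w; apply: tensor_ind => [|w w' [s ->] [s' ->]|u v].
- by exists [::]; rewrite big_nil.
- exists (s ++ [seq (- p.1, p.2) | p <- s']).
  rewrite big_cat big_map -sumrN; congr (_ + _); apply: eq_bigr => p _ /=.
  by rewrite -[in RHS]scaleN1r tpureZl scaleN1r.
- by exists [:: (u, v)]; rewrite big_seq1.
Qed.

(** Induction on the number of terms of [w]. If some [f] in [Fs] is nonzero at [v0], contracting [w]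
    with [f] and dividing by [f v0] gives an element of [I]; its tensor with [v0] is split off, and
    the remainder has one term fewer while its contractions stay in [I]. If there is no such [f],
    then [v0 = 0]. *)
Lemma subtensor_separating V (Fs : set (V -> k^o)) w :
  submod_closed [in I] -> (forall f, Fs f -> linear f) ->
  (forall v, (forall f, Fs f -> f v = 0) -> v = 0) ->
  (forall f, Fs f -> I (tsum (fun u v => (f v : k) *: u) w)) -> subtensor w.
Proof.
move=> IS FL Fsep.
have [I0 IP] := (submod_closedP _).1 IS.
have IZ c u : I u -> I (c *: u) by move=> Iu; rewrite -[_ *: _]addr0; exact: IP.
have IB := ((zmod_closedP _).1 (submod_closed_zmod IS)).2.
have [s0 sP] := (submod_closedP _).1 (@subtensor_closed V).
have [s ->] := tensor_sum w => {w} FI.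
have {FI} : forall f, Fs f -> I (\sum_(p <- s) (f p.2 : k) *: p.1).
  move=> f Ff; have fL := FL f Ff; have := FI f Ff.
  have F2 : bilinear2 (fun (u : U) v => (f v : k) *: u) by linearity.
  have TL := tsum_linear F2.
  suff -> : tsum (fun (u : U) v => (f v : k) *: u) (\sum_(p <- s) p.1 ⊗ p.2) =
    \sum_(p <- s) (f p.2 : k) *: p.1 by [].
  elim: s {FI} => [|p s IH]; first by rewrite !big_nil (zmod_morphism0 (zmod_morphism_linear TL)).
  by rewrite !big_cons (zmod_morphismD (zmod_morphism_linear TL)) IH tsum_bilinear.
have [n] := ubnP (size s); elim: n s => // n IH [|[u0 v0] s] /= ns FI.
  by rewrite big_nil.
have [f0|] := pselect (forall f, Fs f -> f v0 = 0).
  rewrite big_cons /= (Fsep _ f0).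
  rewrite tpure0r add0r.
  by apply: IH => // f Ff; have := FI f Ff; rewrite big_cons /= f0 // scale0r add0r.
move=> /existsNP[f /not_implyP[Ff /eqP fv0]].
(* The second factors are projected along [v0] onto the kernel of [f]. *)
pose s' := [seq (p.1, p.2 - ((f p.2 : k) / f v0) *: v0) | p <- s].
have -> : \sum_(p <- (u0, v0) :: s) p.1 ⊗ p.2 =
    1 *: (((f v0 : k)^-1 *: \sum_(p <- (u0, v0) :: s) (f p.2 : k) *: p.1) ⊗ v0) +
    \sum_(p <- s') p.1 ⊗ p.2.
  rewrite scale1r !big_cons /= scalerDr scalerA mulVf // scale1r tpureDl -addrA.
  congr (_ + _); rewrite {}/s'; elim: s {IH ns FI} => [|p s IHs].
    by rewrite !big_nil scaler0 tpure0l addr0.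
  rewrite /= !big_cons IHs scalerDr tpureDl tpureBr tpureZr /= -tpureZl scalerA.
  by rewrite [(f v0 : k)^-1 * _]mulrC addrACA [X in _ = X + _]addrC subrK.
apply: sP; first by apply: subtensor_pure; apply: IZ; exact: FI.
apply: IH => [|g Fg]; first by rewrite size_map.
have := IB _ _ (FI g Fg) (IZ ((g v0 : k) / f v0) _ (FI f Ff)).
suff -> : \sum_(p <- s') (g p.2 : k) *: p.1 =
  \sum_(p <- (u0, v0) :: s) (g p.2 : k) *: p.1 -
  ((g v0 : k) / f v0) *: \sum_(p <- (u0, v0) :: s) (f p.2 : k) *: p.1 by [].
rewrite !big_cons /= scalerDr scalerA divfK // opprD addrACA subrr add0r.
rewrite {}/s'; elim: s {ns FI} => [|p s IHs].
  by rewrite !big_nil scaler0 subr0.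
rewrite /= !big_cons IHs /= (zmod_morphism_linear (FL g Fg)).
rewrite (scalable_linear (FL g Fg)) scalerBl scalerDr opprD scalerA addrACA.
congr (_ + (- (_ *: _) + _)); exact: etrans (mulrC _ _) (etrans (mulrCA _ _ _) (mulrC _ _)).
Qed.

End Subtensor.

Section SweedlerSet.
Variables (k : fieldType) (H : hopfAlgType k).

Lemma sweedler_set (W : zmodType) (N : set W) (F : H -> H -> W) x :
  zmod_closed [in N] -> tbalanced F -> (forall a b, N (F a b)) ->
  N (sweedler F x).
Proof.
move=> NZ FB FN; apply: (@tensor_set_ind _ _ _ _ N (tsum F)) => // [|a b].
  exact: tsum_additive.
by rewrite tsum_pure.
Qed.

End SweedlerSet.

(** * The kernel of [Q ⊗ Q -> Q ⊗_A Q] *)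

Section TensorOver.
Local Open Scope quotient_scope.
Variables (k : fieldType) (Q : algType k) (A : set Q).
Hypothesis AS : subalg_closed [in A].

Definition balancing_kernel : set (tensor Q Q) :=
  smallest (fun N => zmod_closed [in N])
    [set t | exists p a q, A a /\ t = (p * a) ⊗ q - p ⊗ (a * q)].

Lemma balancing_kernel_closed : zmod_closed [in balancing_kernel].
Proof.
apply/zmod_closedP; split=> [N [/zmod_closedP[]]//|u v Gu Gv N [NP GN]].
by case/zmod_closedP: (NP) => _; apply; [apply: Gu|apply: Gv].
Qed.

(** Scalars pass across [⊗_A] because the subalgebra [A] contains every [c *: 1]. *)
Lemma opure_balanced : tbalanced (opure A).
Proof.
split=> [v|u|u c v].
- by apply: zmod_morphism_ofD => u1 u2; exact: bpure_addl.
- by apply: zmod_morphism_ofD => v1 v2; exact: bpure_addr.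
have Ac : A (c *: 1).
  case: AS => A1 AP AM; have A0 : 0 \in [in A] by have := AP (-1) 1 1 A1 A1; rewrite scaleN1r addNr.
  by have := AP c 1 0 A1 A0; rewrite addr0 inE.
have := bpure_bal (fun (x : Q) (a : {a | A a}) => x * sval a)
  (fun (a : {a | A a}) (y : Q) => sval a * y) u (exist _ _ Ac) v.
by rewrite /= -scalerAr mulr1 -scalerAl mul1r.
Qed.

(** Both tensor products are quotients of the free abelian group on [Q * Q]. For the direct
    implication, [t] is lifted to a formal sum [D]; since [D] is a consequence of the relations over
    [A], it suffices that [E] sends each of these relations into the kernel. *)
Lemma tsum_opure_eq0 t : tsum (opure A) t = 0 <-> balancing_kernel t.
Proof.
have OB := opure_balanced; have [TB1 TB2 _] := @tpure_bal k Q Q.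
split=> [t0|]; last first.
  pose N := [set s | tsum (opure A) s = 0].
  apply: (@smallest_sub _ _ _ N) => [|_ [p [a [q [Aa ->]]]]].
    have OA := tsum_additive OB.
    apply/zmod_closedP; split=> [|u v Nu Nv]; rewrite /N /=.
      exact: zmod_morphism0.
    by rewrite OA Nu Nv subrr.
  rewrite /N /= (tsum_additive OB) !(tsum_pure OB).
  apply/eqP; rewrite subr_eq0; apply/eqP.
  exact: (bpure_bal (fun (x : Q) (a : {a | A a}) => x * sval a)
    (fun (a : {a | A a}) (y : Q) => sval a * y) p (exist _ a Aa) q).
pose ra (x : Q) (a : {a | A a}) := x * sval a.
pose la (a : {a | A a}) (y : Q) := sval a * y.
pose E := fglift (fun p : Q * Q => p.1 ⊗ p.2 : zmodule (tensor Q Q)).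
have EB : zmod_morphism E by exact: lift_is_additive.
pose pr (D : {freeg (Q * Q)%type}) : tensor_over A :=
  \pi_(Quotient.quot (btensor_rel ra la)) D.
have prB : zmod_morphism pr.
  by move=> x y; exact: (raddfB (\pi_(Quotient.quot (btensor_rel ra la)))).
have [D [DE prD]] : exists D, E D = t /\ pr D = tsum (opure A) t.
  move: (t); apply: tensor_ind => [|s s' [D [DE Dpr]] [D' [DE' Dpr']]|u v].
  - have O0 : tsum (opure A) 0 = 0 by exact: zmod_morphism0 (tsum_additive OB).
    exists 0; rewrite O0; split; exact: zmod_morphism0.
  - by exists (D - D'); rewrite EB DE DE' prB Dpr Dpr' (tsum_additive OB).
  - by exists << (u, v) >>; rewrite /E liftU scale1r tsum_pure.
have : btensor_rel ra la D.
  have : D == 0 %[mod Quotient.quot (btensor_rel ra la)].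
    rewrite -[X in X == _]/(pr D) prD t0 -[X in _ == X]/(pr 0).
    by rewrite zmod_morphism0.
  by rewrite -Quotient.idealrBE subr0.
rewrite -DE /btensor_rel inE => /(_ [set D | balancing_kernel (E D)]); apply; split.
  have [K0 KB] := (zmod_closedP _).1 balancing_kernel_closed.
  apply/zmod_closedP; split=> [|x y] /=; first by rewrite zmod_morphism0.
  by rewrite EB; exact: KB.
have [K0 _] := (zmod_closedP _).1 balancing_kernel_closed.
move=> _ [u1 u2 v|u v1 v2|u s v] /=; rewrite !EB /E !liftU !scale1r /=.
- by rewrite (zmod_morphismD (TB1 v)) -addrA -opprD subrr.
- by rewrite (zmod_morphismD (TB2 u)) -addrA -opprD subrr.
- by apply: sub_gen_smallest; exists u, (sval s), v; split=> //; exact: svalP.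
Qed.

End TensorOver.

(** * Right ideals and stability under the right adjoint action *)

Section GaloisElement.
Variables (k : fieldType) (H : hopfAlgType k) (Q : unitAlgType k).
Variable iota : {lrmorphism H -> Q}.
Implicit Types (I : set H) (A : set Q) (N : set (tensor Q Q)).

Local Notation S := (antipode : H -> H).

Definition bimul (p q : Q) : tensor Q Q -> tensor Q Q :=
  tmap (fun x => p * x) (fun y => y * q).

Lemma bimul_linear p q : linear (bimul p q).
Proof. by rewrite /bimul /tmap; linearity. Qed.

Lemma bimul_pure p q u v : bimul p q (u ⊗ v) = (p * u) ⊗ (v * q).
Proof. by rewrite /bimul /tmap tsum_bilinear //; linearity. Qed.

Lemma bimul_bimul p q p' q' t :
  bimul p q (bimul p' q' t) = bimul (p * p') (q' * q) t.
Proof.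
move: t; apply: tensor_linear_ext => [||u v]; last by rewrite !bimul_pure !mulrA.
  exact: linear_comp (bimul_linear _ _) (bimul_linear _ _).
exact: bimul_linear.
Qed.

Definition galois_elt (x : H) : tensor Q Q :=
  sweedler (fun x1 x2 => iota x1 ⊗ iota (S x2)) x.

Definition galois_mul (h : H) : tensor Q Q -> tensor Q Q :=
  tsum (fun p q => sweedler (fun h1 h2 => (p * iota h1) ⊗ (iota (S h2) * q)) h).

Lemma galois_mul_bilinear : bilinear2 galois_mul.
Proof. by rewrite /galois_mul; linearity. Qed.

Lemma galois_mul_pure h p q : galois_mul h (p ⊗ q) =
  sweedler (fun h1 h2 => (p * iota h1) ⊗ (iota (S h2) * q)) h.
Proof. by rewrite /galois_mul tsum_bilinear //; linearity. Qed.

(** Follows from multiplicativity of the coproduct and [antipodeM]. It carries right multiplication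
    by [h] on [H] over to [Q ⊗ Q]. *)
Lemma galois_mul_galois_elt h x :
  galois_mul h (galois_elt x) = galois_elt (x * h).
Proof.
rewrite /galois_elt (@linear_sweedler _ _ _ _ (galois_mul h));
  [|exact: galois_mul_bilinear.2|by linearity].
rewrite sweedlerM; last by linearity.
apply: eq_sweedler => a b; rewrite galois_mul_pure.
by apply: eq_sweedler => c d; rewrite antipodeM !rmorphM.
Qed.

Lemma galois_mul_bimul h p q t :
  galois_mul h (bimul p q t) = bimul p q (galois_mul h t).
Proof.
have ML := galois_mul_bilinear.2 h; have BL := bimul_linear p q.
move: t; apply: tensor_linear_ext => [||u v]; [exact: linear_comp ML BL|exact: linear_comp BL ML|].
rewrite bimul_pure 2!galois_mul_pure (@linear_sweedler _ _ _ _ (bimul p q));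
  [|exact: BL|by linearity].
by apply: eq_sweedler => a b; rewrite bimul_pure !mulrA.
Qed.

Lemma generated_subbimodule_closed I :
  subbimodule (generated_subbimodule iota I).
Proof.
split.
  apply/zmod_closedP; split=> [N [[/zmod_closedP[]]]//|u v Gu Gv N [[NZ NM] GN]].
  by case/zmod_closedP: (NZ) => _; apply; [apply: Gu|apply: Gv].
move=> p q t Gt N [[NZ NM] GN]; by apply: (NM); apply: Gt.
Qed.

(** As [galois_mul h] commutes with the outer bimodule structure, only the generators have to be
    examined. *)
Lemma generated_subbimodule_galois_mul I h t :
  (forall x, I x -> I (x * h)) ->
  generated_subbimodule iota I t -> generated_subbimodule iota I (galois_mul h t).
Proof.
move=> Ih; have [GZ GM] := generated_subbimodule_closed I.
have ML := zmod_morphism_linear (galois_mul_bilinear.2 h).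
pose N := [set t | generated_subbimodule iota I (galois_mul h t)].
apply: (@smallest_sub _ _ _ N) => [|_ [x Ix <-]].
  have [G0 GB] := (zmod_closedP _).1 GZ.
  split; first apply/zmod_closedP; first split.
  - by rewrite /N /= zmod_morphism0.
  - by move=> u v Nu Nv; rewrite /N /= ML; exact: GB.
  - by move=> p q u Nu; rewrite /N /= galois_mul_bimul; exact: GM.
rewrite /N /= galois_mul_galois_elt.
by apply: sub_gen_smallest; exists (x * h) => //; exact: Ih.
Qed.

Lemma bimul_galois_mul_trilinear s :
  trilinear (fun h1 h2 h3 => bimul (iota (S h1)) (iota h3) (galois_mul h2 s)).
Proof.
have B1 : forall r t, linear (fun p => bimul p r t).
  by move=> r t; rewrite /bimul /tmap; linearity.
have B2 : forall p t, linear (fun r => bimul p r t).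
  by move=> p t; rewrite /bimul /tmap; linearity.
split=> a b.
- apply: (linear_comp (g := fun p => bimul p (iota b) (galois_mul a s))
    (f := fun u => iota (S u))); [exact: B1|by linearity].
- apply: (linear_comp (g := bimul (iota (S a)) (iota b))
    (f := fun u => galois_mul u s)).
    exact: bimul_linear.
  exact: galois_mul_bilinear.1.
- apply: (linear_comp (g := fun p => bimul (iota (S a)) p (galois_mul b s))
    (f := iota)); [exact: B2|by linearity].
Qed.

(** The term of [1 ⊗ q] is [S(h_(1)) h_(2) ⊗ S(h_(3)) q h_(4)], where the first factor cancels; the
    term of [q ⊗ 1] is [S(h_(1)) q h_(2) ⊗ S(h_(3)) h_(4)], where the second factor cancels. *)
Lemma right_adjoint_commutator q h :
  1 ⊗ right_adjoint iota q h - right_adjoint iota q h ⊗ 1 =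
  sweedler (fun h1 h' => sweedler (fun h2 h3 =>
    bimul (iota (S h1)) (iota h3) (galois_mul h2 (1 ⊗ q - q ⊗ 1))) h') h.
Proof.
have FL := bimul_galois_mul_trilinear.
have expand p r : sweedler (fun h1 h' => sweedler (fun h2 h3 =>
    bimul (iota (S h1)) (iota h3) (galois_mul h2 (p ⊗ r))) h') h =
    sweedler (fun h1 h' => sweedler (fun c e => sweedler (fun d h3 =>
      (iota (S h1) * p * iota c) ⊗ (iota (S d) * r * iota h3)) e) h') h.
  apply: eq_sweedler => h1 h'.
  rewrite -(@sweedler_coassoc _ _ _ (fun c d h3 =>
    (iota (S h1) * p * iota c) ⊗ (iota (S d) * r * iota h3))); last by linearity.
  apply: eq_sweedler => h2 h3.
  rewrite galois_mul_pure (@linear_sweedler _ _ _ _ (bimul (iota (S h1)) (iota h3)));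
    [|exact: bimul_linear|by linearity].
  by apply: eq_sweedler => c d; rewrite bimul_pure !mulrA.
have RL : linear (fun s => sweedler (fun h1 h' => sweedler (fun h2 h3 =>
    bimul (iota (S h1)) (iota h3) (galois_mul h2 s)) h') h).
  apply: linear_tsum_fun => [s|a b]; first exact: trilinear_sweedler.
  apply: linear_tsum_fun => [s|c d]; first exact: trilinear_bilinear2 (FL s).
  apply: (linear_comp (g := bimul (iota (S a)) (iota d)) (f := galois_mul c)).
    exact: bimul_linear.
  exact: galois_mul_bilinear.2.
rewrite (zmod_morphism_linear RL) (expand 1 q) (expand q 1); congr (_ - _).
  pose G u e := iota u ⊗ sweedler (fun d h3 => iota (S d) * q * iota h3) e.
  transitivity (sweedler (fun h1 h' => sweedler (fun c e => G (S h1 * c) e) h') h).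
    by rewrite (@sweedler_antipode_mul_l _ _ _ G) /G ?rmorph1 //; linearity.
  apply: eq_sweedler => h1 h'; apply: eq_sweedler => c e.
  rewrite /G (@linear_sweedler _ _ _ _ (tpure (iota (S h1 * c)))); try by linearity.
  by apply: eq_sweedler => d h3; rewrite rmorphM mulr1.
rewrite /right_adjoint (@linear_sweedler _ _ _ _ (fun x : Q => x ⊗ (1 : Q))); try by linearity.
apply: eq_sweedler => h1 h'; rewrite -(rmorph1 iota).
rewrite -(@sweedler_antipode_mul_r _ _ _
  (fun c m => (iota (S h1) * q * iota c) ⊗ iota m)); last by linearity.
apply: eq_sweedler => c e; apply: eq_sweedler => d h3.
by rewrite rmorph1 mulr1 rmorphM.
Qed.

(** By [right_adjoint_commutator], the commutator that tests [q <| h] is a sum of outer multiples of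
    [galois_mul] images of the commutator that tests [q]. *)
Lemma two_sided_right_adjoint_stable I A :
  two_sided_ideal I ->
  A = [set q | generated_subbimodule iota I (1 ⊗ q - q ⊗ 1)] ->
  right_adjoint_stable iota A.
Proof.
move=> [_ IR] -> q h; rewrite /= => Nq.
have [NZ NM] := generated_subbimodule_closed I.
have FL := bimul_galois_mul_trilinear (1 ⊗ q - q ⊗ 1).
rewrite right_adjoint_commutator; apply: sweedler_set => // [|h1 h'].
  exact/bilinear2_balanced/trilinear_sweedler.
apply: sweedler_set => // [|h2 h3].
  exact: bilinear2_balanced (trilinear_bilinear2 _ FL).
have := @generated_subbimodule_galois_mul I h2 (1 ⊗ q - q ⊗ 1) (IR h2) Nq.
exact: NM.
Qed.

Lemma right_adjoint_linear q : linear (right_adjoint iota q).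
Proof. by rewrite /right_adjoint; linearity. Qed.

(* From [a h = h_(1) (a <| h_(2))] and [S(h) a = (a <| h_(1)) S(h_(2))]. *)
Lemma galois_mul_balancing p a q h :
  galois_mul h ((p * a) ⊗ q - p ⊗ (a * q)) =
  sweedler (fun h1 h' => sweedler (fun h2 h3 =>
    (p * iota h1 * right_adjoint iota a h2) ⊗ (iota (S h3) * q) -
    (p * iota h1) ⊗ (right_adjoint iota a h2 * (iota (S h3) * q))) h') h.
Proof.
have AL := right_adjoint_linear a.
rewrite (zmod_morphism_linear (galois_mul_bilinear.2 h)) !galois_mul_pure.
transitivity (sweedler (fun h1 h' => sweedler (fun h2 h3 =>
    (p * iota h1 * right_adjoint iota a h2) ⊗ (iota (S h3) * q)) h') h -
  sweedler (fun h1 h' => sweedler (fun h2 h3 =>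
    (p * iota h1) ⊗ (right_adjoint iota a h2 * (iota (S h3) * q))) h') h).
  congr (_ - _).
    pose G u e := sweedler (fun d h3 =>
      (p * iota u * a * iota d) ⊗ (iota (S h3) * q)) e.
    transitivity (G 1 h); first by rewrite /G rmorph1 mulr1.
    rewrite -(@sweedler_mul_antipode_l _ _ _ G h); last by rewrite /G; linearity.
    apply: eq_sweedler => h1 h'.
    rewrite -(@sweedler_coassoc _ _ _ (fun c d h3 =>
      (p * iota (h1 * S c) * a * iota d) ⊗ (iota (S h3) * q))); last by linearity.
    apply: eq_sweedler => h2 h3.
    rewrite /right_adjoint.
    rewrite (@linear_sweedler _ _ _ _
      (fun u : Q => (p * iota h1 * u) ⊗ (iota (S h3) * q))); try by linearity.
    by apply: eq_sweedler => c d; rewrite rmorphM !mulrA.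
  apply: eq_sweedler => h1 h'.
  transitivity ((p * iota h1) ⊗ (iota (S h') * a * iota 1 * q)).
    by rewrite rmorph1 mulr1 mulrA.
  rewrite -(@sweedler_mul_antipode_r _ _ _
    (fun c m => (p * iota h1) ⊗ (iota (S c) * a * iota m * q))); last by linearity.
  rewrite -(@sweedler_coassoc _ _ _ (fun c d h3 =>
    (p * iota h1) ⊗ (iota (S c) * a * iota (d * S h3) * q))); last by linearity.
  apply: eq_sweedler => h2 h3.
  rewrite /right_adjoint.
  rewrite (@linear_sweedler _ _ _ _
    (fun u : Q => (p * iota h1) ⊗ (u * (iota (S h3) * q)))); try by linearity.
  by apply: eq_sweedler => c d; rewrite rmorphM !mulrA.
rewrite -sweedlerB; try by linearity.
by apply: eq_sweedler => h1 h'; rewrite sweedlerB //; linearity.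
Qed.

(** By [galois_mul_balancing], the image of a balancing relation for [a] is a sum of balancing
    relations for the elements [a <| h_(2)]. *)
Lemma balancing_kernel_galois_mul A h t :
  right_adjoint_stable iota A -> balancing_kernel A t ->
  balancing_kernel A (galois_mul h t).
Proof.
move=> Aad; have KZ := balancing_kernel_closed A.
have [K0 KB] := (zmod_closedP _).1 KZ.
have ML := zmod_morphism_linear (galois_mul_bilinear.2 h).
pose N := [set t | balancing_kernel A (galois_mul h t)].
apply: (@smallest_sub _ _ _ N) => [|_ [p [a [q [Aa ->]]]]].
  apply/zmod_closedP; split; first by rewrite /N /= zmod_morphism0.
  by move=> u v Nu Nv; rewrite /N /= ML; exact: KB.
have AL := right_adjoint_linear a.
rewrite /N /= galois_mul_balancing.
apply: sweedler_set => // [|h1 h']; first by apply: bilinear2_balanced; linearity.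
apply: sweedler_set => // [|h2 h3]; first by apply: bilinear2_balanced; linearity.
apply: sub_gen_smallest; exists (p * iota h1), (right_adjoint iota a h2), (iota (S h3) * q).
by split=> //; exact: Aad.
Qed.

Lemma opure_galois_elt A x : subalg_closed [in A] ->
  sweedler (fun x1 x2 => opure A (iota x1) (iota (S x2))) x = 0 <->
  balancing_kernel A (galois_elt x).
Proof.
move=> AS; rewrite -tsum_opure_eq0 //.
have OB := opure_balanced AS; have OZ := tsum_additive OB.
suff -> : tsum (opure A) (galois_elt x) =
   sweedler (fun x1 x2 => opure A (iota x1) (iota (S x2))) x by [].
have [Ol Or Ob] := OB.
have OSB : tbalanced (fun x1 x2 : H => opure A (iota x1) (iota (S x2))).
  split=> [v u u'|u v v'|u c v].
  - by rewrite rmorphB Ol.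
  - by rewrite linearB rmorphB Or.
  - by rewrite !linearZ /= Ob.
have GB : bilinear2 (fun x1 x2 => iota x1 ⊗ iota (S x2)) by linearity.
rewrite /galois_elt /sweedler; move: (comul x).
apply: tensor_ext => [s t||u v]; last by rewrite tsum_bilinear // !tsum_pure.
  by rewrite (zmod_morphism_linear (tsum_linear GB)) OZ.
exact: tsum_additive.
Qed.

Lemma right_adjoint_stable_two_sided I A :
  subalg_closed [in A] -> left_ideal I ->
  I = [set x | sweedler (fun x1 x2 =>
         opure A (iota x1) (iota (antipode x2))) x = 0] ->
  right_adjoint_stable iota A -> two_sided_ideal I.
Proof.
move=> AS IL IE Aad; split=> // h x; rewrite IE /= !opure_galois_elt // => Kx.
by rewrite -galois_mul_galois_elt; exact: balancing_kernel_galois_mul.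
Qed.

End GaloisElement.

(** * Matrix coefficients of finite-dimensional quotients of [H] *)

Section MatrixCoefficients.
Variables (k : fieldType) (H : hopfAlgType k).

(** The product formula is an explicit coproduct of [F i j] in the sense of [dual_comul], so that
    [act_mul] expands an action on a product within the same family. *)
Definition matrix_representation n (F : 'I_n -> 'I_n -> H -> k) : Prop :=
  (forall i j, finite_dual H (F i j)) /\
  (forall i j x y, F i j (x * y) = \sum_l F i l x * F l j y).

(** A spanning family of least size is free modulo [J]: in a relation with [c i != 0] the vector
    [b i] could be eliminated. *)
Lemma finite_codim_basis (J : set H) :
  submod_closed [in J] -> finite_codim J ->
  exists (n : nat) (b : 'I_n -> H),
    (forall x, exists c : 'I_n -> k, J (x - \sum_i c i *: b i)) /\
    (forall c : 'I_n -> k, J (\sum_i c i *: b i) -> forall i, c i = 0).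
Proof.
move=> /submod_closedP[J0 JP] [n0 [b0 b0P]].
pose P n := `[< exists b : 'I_n -> H,
  forall x, exists c : 'I_n -> k, J (x - \sum_i c i *: b i) >].
have exP : exists n, P n by exists n0; apply/asboolP; exists b0.
have [n /asboolP[b bP] n_min] := ex_minnP exP.
exists n, b; split=> // c Jc i; apply/eqP/negP => /negP ci.
case: n b bP n_min c i Jc ci => [|n] b bP n_min c i Jc ci; first by case: i ci.
have : P n.
  apply/asboolP; exists (fun j => b (fintype.lift i j)) => x.
  have [d dP] := bP x.
  exists (fun j => d (fintype.lift i j) - d i / c i * c (fintype.lift i j)).
  have := JP (d i / c i) _ _ Jc dP.
  congr (J _); rewrite addrCA; congr (_ + _).
  rewrite !(bigD1_ord i) //= opprD scalerDr scalerA divfK // addrACA subrr add0r.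
  rewrite scaler_sumr -sumrB -sumrN; apply: eq_bigr => j _.
  by rewrite scalerBl opprB scalerA.
by move=> /n_min; rewrite ltnn.
Qed.

(** For each ideal [J] of finite codimension, the coefficients of left multiplication on [H / J] are
    used. If they vanish at [x], then [x * b j] is in [J] for all [j], and writing [1] in terms of
    the [b j] modulo [J] gives [x] in [J]. *)
Lemma matrix_representation_separating (Hfd : residually_finite_dim H) x :
  (forall n (F : 'I_n -> 'I_n -> H -> k) i j,
     matrix_representation F -> F i j x = 0) -> x = 0.
Proof.
move=> Fx; apply: Hfd => J J2 Jfin.
have [[JS JL] JR] := J2.
have [J0 JP] := (submod_closedP _).1 JS.
have JB := ((zmod_closedP _).1 (submod_closed_zmod JS)).2.
have [n [b [b_span b_free]]] := finite_codim_basis JS Jfin.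
have coordP y : exists c : 'I_n -> k, J (y - \sum_i c i *: b i) := b_span y.
have [coord cP] := choice coordP.
have cE y (c : 'I_n -> k) : J (y - \sum_i c i *: b i) -> forall i, coord y i = c i.
  move=> Jc i; apply/eqP; rewrite -subr_eq0; apply/eqP.
  apply: (b_free (fun i => coord y i - c i)).
  have := JB _ _ Jc (cP y); congr (J _).
  rewrite opprB addrC subrKA -sumrB; apply: eq_bigr => l _; by rewrite scalerBl.
(* Column [j] holds the coordinates of [y * b j] modulo [J]. *)
pose F i j y := coord (y * b j) i.
have FB i j : scalar (F i j).
  move=> c y z; apply: (cE _ (fun i => c * F i j y + F i j z)) => /=.
  have := JP c _ _ (cP (y * b j)) (cP (z * b j)); congr (J _).
  rewrite mulrDl -scalerAl scalerBr addrACA -opprD; congr (_ - _).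
  rewrite scaler_sumr -big_split; apply: eq_bigr => l _.
  by rewrite /= scalerDl scalerA.
have FM i j y z : F i j (y * z) = \sum_l F i l y * F l j z.
  apply: (cE _ (fun i => \sum_l F i l y * F l j z)).
  have JS' : J (\sum_l F l j z *: (y * b l - \sum_m F m l y *: b m)).
    apply: big_ind => // [u v Ju Jv|l _]; first by rewrite -[u]scale1r; exact: JP.
    by rewrite -[_ *: _]addr0; apply: JP => //; exact: cP.
  have := JP 1 _ _ (JL y _ (cP (z * b j))) JS'; congr (J _).
  rewrite scale1r mulrBr mulrA -addrA; congr (_ + _).
  rewrite mulr_sumr -sumrN -big_split /=.
  transitivity (\sum_l - \sum_m (F m l y * F l j z) *: b m).
    apply: eq_bigr => l _; rewrite -scalerAr scalerBr addrA addNr sub0r scaler_sumr.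
    by congr (- _); apply: eq_bigr => m _; rewrite scalerA mulrC.
  rewrite sumrN exchange_big; congr (- _); apply: eq_bigr => m _.
  by rewrite scaler_suml.
have F_rep : matrix_representation F.
  split=> // i j; split=> //; exists J; split=> // y Jy.
  apply: (cE _ (fun _ => 0)).
  rewrite big1 ?subr0; first exact: JR.
  by move=> l _; rewrite scale0r.
have [d dP] := b_span 1.
have Jxb : J (\sum_i d i *: (x * b i)).
  apply: big_ind => // [u v Ju Jv|j _]; first by rewrite -[u]scale1r; exact: JP.
  rewrite -[_ *: _]addr0; apply: JP => //.
  have := cP (x * b j); rewrite big1 ?subr0 // => i _.
  by rewrite -[coord _ i]/(F i j x) Fx ?scale0r.
have := JP 1 _ _ (JL x _ dP) Jxb; congr (J _).
rewrite scale1r mulrBr mulr1 mulr_sumr -addrA -[RHS]addr0; congr (_ + _).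
by rewrite addrC -sumrB big1 // => i _; rewrite -scalerAr subrr.
Qed.

End MatrixCoefficients.

(** * The twisting automorphism of [H ⊗ Q] and the action of functionals *)

Section Twist.
Variables (k : fieldType) (H : hopfAlgType k) (Q : unitAlgType k).
Variable iota : {lrmorphism H -> Q}.

Local Notation S := (antipode : H -> H).

Definition tmulr (V : lmodType k) (R : algType k) (q : R) :
  tensor V R -> tensor V R := tmap (fun x => x) (fun y => y * q).

Definition tmull (V : lmodType k) (R : algType k) (q : R) :
  tensor V R -> tensor V R := tmap (fun x => x) (fun y => q * y).

Lemma tmulr_linear V (R : algType k) (q : R) : linear (@tmulr V R q).
Proof. by apply: tmap_linear; linearity. Qed.

Lemma tmulr_pure (V : lmodType k) (R : algType k) (q : R) (x : V) y :
  tmulr q (x ⊗ y) = x ⊗ (y * q).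
Proof. by apply: tmap_pure; linearity. Qed.

Lemma tmull_linear V (R : algType k) (q : R) : linear (@tmull V R q).
Proof. by apply: tmap_linear; linearity. Qed.

Lemma tmull_pure (V : lmodType k) (R : algType k) (q : R) (x : V) y :
  tmull q (x ⊗ y) = x ⊗ (q * y).
Proof. by apply: tmap_pure; linearity. Qed.

Definition embl : tensor H Q -> tensor Q Q := tmap iota (fun y => y).
Definition embr : tensor H H -> tensor H Q := tmap (fun x => x) iota.

Lemma embl_linear : linear embl.
Proof. by apply: tmap_linear; linearity. Qed.

Lemma embl_pure x q : embl (x ⊗ q) = iota x ⊗ q.
Proof. by apply: tmap_pure; linearity. Qed.

Lemma embr_linear : linear embr.
Proof. by apply: tmap_linear; linearity. Qed.

Lemma embr_pure x y : embr (x ⊗ y) = x ⊗ iota y.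
Proof. by apply: tmap_pure; linearity. Qed.

Lemma embr_tmulr y z : embr (tmulr y z) = tmulr (iota y) (embr z).
Proof.
have EL := embr_linear.
have ML (R : algType k) (q : R) : linear (@tmulr H R q) by exact: tmulr_linear.
move: z; apply: tensor_linear_ext => [||u v].
- exact: linear_comp EL (ML _ y).
- exact: linear_comp (ML _ (iota y)) EL.
- by rewrite tmulr_pure !embr_pure tmulr_pure rmorphM.
Qed.

(* [untwist] maps [I (x) Q] onto the right [Q]-span of the elements
   [x_(1) (x) S(x_(2))] with [x] in [I]. *)
Definition twist : tensor H Q -> tensor H Q :=
  tsum (fun x q => sweedler (fun a b => a ⊗ (iota b * q)) x).

Definition untwist : tensor H Q -> tensor H Q :=
  tsum (fun x q => sweedler (fun a b => a ⊗ (iota (S b) * q)) x).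

Lemma twist_linear : linear twist.
Proof. by rewrite /twist; linearity. Qed.

Lemma twist_pure x q : twist (x ⊗ q) = sweedler (fun a b => a ⊗ (iota b * q)) x.
Proof. by rewrite /twist tsum_bilinear //; linearity. Qed.

Lemma untwist_linear : linear untwist.
Proof. by rewrite /untwist; linearity. Qed.

Lemma untwist_pure x q :
  untwist (x ⊗ q) = sweedler (fun a b => a ⊗ (iota (S b) * q)) x.
Proof. by rewrite /untwist tsum_bilinear //; linearity. Qed.

Lemma twistK : cancel twist untwist.
Proof.
have TL := twist_linear; have UL := untwist_linear.
apply: tensor_linear_ext => [||x q]; [exact: linear_comp|by []|].
rewrite twist_pure (@linear_sweedler _ _ _ _ untwist) //; last by linearity.
rewrite -[in RHS](mul1r q) -(rmorph1 iota).
rewrite -(@sweedler_antipode_mul_r _ _ _ (fun c m => c ⊗ (iota m * q))); last by linearity.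
rewrite -(@sweedler_coassoc _ _ _ (fun a c d => a ⊗ (iota (S c * d) * q))); last by linearity.
apply: eq_sweedler => a b; rewrite untwist_pure.
by apply: eq_sweedler => c d; rewrite rmorphM mulrA.
Qed.

Lemma untwistK : cancel untwist twist.
Proof.
have TL := twist_linear; have UL := untwist_linear.
apply: tensor_linear_ext => [||x q]; [exact: linear_comp|by []|].
rewrite untwist_pure (@linear_sweedler _ _ _ _ twist) //; last by linearity.
rewrite -[in RHS](mul1r q) -(rmorph1 iota).
rewrite -(@sweedler_mul_antipode_r _ _ _ (fun c m => c ⊗ (iota m * q))); last by linearity.
rewrite -(@sweedler_coassoc _ _ _ (fun a c d => a ⊗ (iota (c * S d) * q))); last by linearity.
apply: eq_sweedler => a b; rewrite twist_pure.
by apply: eq_sweedler => c d; rewrite rmorphM mulrA.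
Qed.

Lemma embl_untwist_tmulr q z :
  embl (untwist (tmulr q z)) = bimul 1 q (embl (untwist z)).
Proof.
have EL := embl_linear; have UL := untwist_linear; have ML := @tmulr_linear H Q q.
have BL := @bimul_linear k Q 1 q.
move: z; apply: tensor_linear_ext => [||x y].
- exact: linear_comp EL (linear_comp UL ML).
- exact: linear_comp BL (linear_comp EL UL).
rewrite tmulr_pure !untwist_pure (@linear_sweedler _ _ _ _ embl) //; last by linearity.
rewrite (@linear_sweedler _ _ _ _ embl) //; last by linearity.
rewrite (@linear_sweedler _ _ _ _ (bimul 1 q)) //; last first.
  by split=> w; apply: (linear_comp (g := embl)) => //; linearity.
by apply: eq_sweedler => a b; rewrite !embl_pure bimul_pure mul1r mulrA.
Qed.

Lemma embl_untwist_pure x q :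
  embl (untwist (x ⊗ q)) = bimul 1 q (galois_elt iota x).
Proof.
have EL := embl_linear; have BL := @bimul_linear k Q 1 q.
rewrite untwist_pure (@linear_sweedler _ _ _ _ embl) //; last by linearity.
rewrite /galois_elt (@linear_sweedler _ _ _ _ (bimul 1 q)) //; last by linearity.
by apply: eq_sweedler => a b; rewrite embl_pure bimul_pure mul1r.
Qed.

(* [f ⇀ x] *)
Definition lact (f : H -> k) (x : H) : H := sweedler (fun a b => f b *: a) x.

Lemma lact_linear f : linear (f : H -> k^o) -> linear (lact f).
Proof. by move=> fL; rewrite /lact; linearity. Qed.

(** Coassociativity: the coproduct of [f ⇀ x] is [x_(1) ⊗ (f ⇀ x_(2))]. *)
Lemma twist_lact f x q : linear (f : H -> k^o) ->
  twist (lact f x ⊗ q) = sweedler (fun a b => a ⊗ (iota (lact f b) * q)) x.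
Proof.
move=> fL; have WL : linear (fun y : H => twist (y ⊗ q)).
  apply: (linear_comp (g := twist) (f := fun y => y ⊗ q)); last by linearity.
  exact: twist_linear.
rewrite {1}/lact (@linear_sweedler _ _ _ _ (fun y => twist (y ⊗ q))) //; last by linearity.
transitivity (sweedler (fun a b => sweedler (fun c d =>
    (f b : k) *: (c ⊗ (iota d * q))) a) x).
  apply: eq_sweedler => a b; rewrite (scalable_linear WL) twist_pure.
  apply: (linear_sweedler (g := fun t => (f b : k) *: t)); last by linearity.
  exact: (linear_scaler _ (@linear_idfun _ _)).
rewrite (@sweedler_coassoc _ _ _ (fun c d b => (f b : k) *: (c ⊗ (iota d * q))));
  last by linearity.
apply: eq_sweedler => a b.
rewrite /lact (@linear_sweedler _ _ _ _ (fun y => a ⊗ (iota y * q))); try by linearity.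
by apply: eq_sweedler => c d; rewrite linearZ -scalerAl tpureZr.
Qed.

End Twist.

(** * The kernel of [H ⊗ Q -> Q ⊗_A Q] lies in [I ⊗ Q] *)

Section GaloisKernel.
Variables (k : fieldType) (H : hopfAlgType k) (Q : unitAlgType k).
Variable iota : {lrmorphism H -> Q}.
Variables (act : (H -> k) -> Q -> Q) (I : set H) (A : set Q).
Hypothesis Hfd : residually_finite_dim H.
Hypothesis Hact : extended_action iota act.
Hypothesis Aact : forall f q, finite_dual H f -> A q -> A (act f q).
Hypothesis IS : submod_closed [in I].
Hypothesis IK : forall x, I x <-> balancing_kernel A (galois_elt iota x).

Local Notation S := (antipode : H -> H).
Local Notation K := (balancing_kernel A).

Lemma balancing_kernel_bimul p q t : K t -> K (bimul p q t).
Proof.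
have BL := zmod_morphism_linear (bimul_linear p q).
have [K0 KB] := (zmod_closedP _).1 (balancing_kernel_closed A).
pose N := [set t | K (bimul p q t)].
apply: (@smallest_sub _ _ _ N) => [|_ [u [a [v [Aa ->]]]]].
  apply/zmod_closedP; split; first by rewrite /N /= zmod_morphism0.
  by move=> s s' Ns Ns'; rewrite /N /= BL; exact: KB.
rewrite /N /= BL !bimul_pure; apply: sub_gen_smallest.
by exists (p * u), a, (v * q); rewrite !mulrA.
Qed.

Lemma balancing_kernelZ c t : K t -> K (c *: t).
Proof.
suff -> : c *: t = bimul (c *: 1) 1 t by exact: balancing_kernel_bimul.
have BL := @bimul_linear k Q (c *: 1) 1.
move: t; apply: tensor_linear_ext => [||u v]; last 1 first.
- by rewrite bimul_pure mulr1 -scalerAl mul1r tpureZl.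
- exact: (linear_scaler c (@linear_idfun _ _)).
- exact: BL.
Qed.

Lemma balancing_kernel_submod : submod_closed [in K].
Proof.
have KZ := balancing_kernel_closed A.
apply/submod_closedP; split=> [|c u v Ku Kv]; first by have [] := (zmod_closedP _).1 KZ.
by apply: (@zmod_closed_set_add _ K) => //; exact: balancing_kernelZ.
Qed.

Section Representation.
Variables (n : nat) (F : 'I_n -> 'I_n -> H -> k).
Hypothesis F_rep : matrix_representation F.

Let F_fin i j : finite_dual H (F i j). Proof. by case: F_rep => + _; apply. Qed.
Let F_lin i j : linear (F i j : H -> k^o). Proof. by case: (F_fin i j). Qed.
Let act_lin i j : linear (act (F i j)). Proof. exact: (act_linear Hact). Qed.
Let lact_lin i j : linear (lact (F i j)). Proof. exact: lact_linear. Qed.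

Lemma act_mul_rep i j p q :
  act (F i j) (p * q) = \sum_l act (F i l) p * act (F l j) q.
Proof.
apply: (act_mul Hact); first exact: F_fin.
by split=> // x y; case: F_rep => _ ->.
Qed.

(** The diagonal action of the functional [F i j] on [Q ⊗ Q], through its coproduct; [hact] is its
    counterpart on [H ⊗ Q]. *)
Definition tact i j (t : tensor Q Q) : tensor Q Q :=
  \sum_l tmap (act (F i l)) (act (F l j)) t.

Definition hact i j (t : tensor H Q) : tensor H Q :=
  \sum_l tmap (lact (F i l)) (act (F l j)) t.

Lemma tact_linear i j : linear (tact i j).
Proof.
move=> c s t; rewrite /tact scaler_sumr -big_split; apply: eq_bigr => l _ /=.
exact: tmap_linear.
Qed.

Lemma hact_linear i j : linear (hact i j).
Proof.
move=> c s t; rewrite /hact scaler_sumr -big_split; apply: eq_bigr => l _ /=.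
exact: tmap_linear.
Qed.

Lemma tpure_suml (U V : lmodType k) m (u : 'I_m -> U) (v : V) :
  (\sum_l u l) ⊗ v = \sum_l u l ⊗ v.
Proof.
apply: (big_morph (fun u : U => u ⊗ v)) => [x y|]; [exact: tpureDl|exact: tpure0l].
Qed.

Lemma tpure_sumr (U V : lmodType k) m (u : U) (v : 'I_m -> V) :
  u ⊗ (\sum_l v l) = \sum_l u ⊗ v l.
Proof.
apply: (big_morph (fun v : V => u ⊗ v)) => [x y|]; last exact: tpure0r.
exact: (zmod_morphismD (zmod_morphism_linear ((tpure_bilinear U V).2 u))).
Qed.

(** Expanding the action on the products [p * a] and [a * q] turns a balancing relation for [a] into
    a double sum of balancing relations for the elements [act (F m l) a], which are in [A] by
    invariance. *)
Lemma balancing_kernel_tact i j t : K t -> K (tact i j t).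
Proof.
have TL := zmod_morphism_linear (tact_linear i j).
have [K0 KB] := (zmod_closedP _).1 (balancing_kernel_closed A).
have KD u v : K u -> K v -> K (u + v).
  by apply: (@zmod_closed_set_add _ K); exact: balancing_kernel_closed.
pose N := [set t | K (tact i j t)].
apply: (@smallest_sub _ _ _ N) => [|_ [p [a [q [Aa ->]]]]].
  apply/zmod_closedP; split; first by rewrite /N /= zmod_morphism0.
  by move=> u v Nu Nv; rewrite /N /= TL; exact: KB.
rewrite /N /= TL /tact.
under eq_bigr do rewrite tmap_pure // act_mul_rep tpure_suml.
under [X in _ - X]eq_bigr do rewrite tmap_pure // act_mul_rep tpure_sumr.
rewrite [X in _ - X]exchange_big -sumrB; apply: (big_ind (fun t => K t)) => // l _.
rewrite -sumrB; apply: (big_ind (fun t => K t)) => // m _; apply: sub_gen_smallest.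
by exists (act (F i m) p), (act (F m l) a), (act (F l j) q); split=> //; exact: Aact.
Qed.

Lemma embl_hact i j t : embl iota (hact i j t) = tact i j (embl iota t).
Proof.
have EL := embl_linear iota; have TL := tact_linear i j; have HL := hact_linear i j.
move: t; apply: tensor_linear_ext => [||x q].
- exact: linear_comp EL HL.
- exact: linear_comp TL EL.
rewrite /hact /tact embl_pure (big_morph _ (zmod_morphismD (zmod_morphism_linear EL))
  (zmod_morphism0 (zmod_morphism_linear EL))).
apply: eq_bigr => l _; rewrite !tmap_pure // embl_pure.
by rewrite (act_iota Hact).
Qed.

(** By [twist_lact] and the module algebra law, [twist] converts the diagonal action into the action
    on the second factor alone. This is what makes the kernel a subcomodule in the second factor. *)
Lemma twist_hact i j t :
  twist iota (hact i j t) = tmap (fun x => x) (act (F i j)) (twist iota t).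
Proof.
have WL := twist_linear iota; have HL := hact_linear i j.
have ML : linear (tmap (fun x : H => x) (act (F i j))) by exact: tmap_linear.
move: t; apply: tensor_linear_ext => [||x q].
- exact: linear_comp WL HL.
- exact: linear_comp ML WL.
rewrite twist_pure (@linear_sweedler _ _ _ _ (tmap _ _)) //; last by linearity.
rewrite /hact (big_morph _ (zmod_morphismD (zmod_morphism_linear WL))
  (zmod_morphism0 (zmod_morphism_linear WL))).
transitivity (sweedler (fun a b => \sum_l
    a ⊗ (iota (lact (F i l) b) * act (F l j) q)) x).
  rewrite sweedler_sum; last by move=> l; linearity.
  by apply: eq_bigr => l _; rewrite tmap_pure // twist_lact.
apply: eq_sweedler => a b; rewrite tmap_pure // act_mul_rep tpure_sumr.
by apply: eq_bigr => l _; rewrite (act_iota Hact).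
Qed.

End Representation.

Let KQ : set (tensor H Q) := [set z | K (embl iota (untwist iota z))].

Lemma untwist_kernel_submod : submod_closed [in KQ].
Proof.
have [K0 KP] := (submod_closedP _).1 balancing_kernel_submod.
have EL : linear (fun z => embl iota (untwist iota z)).
  exact: linear_comp (embl_linear _) (untwist_linear _).
apply/submod_closedP; split; last first.
  by move=> c u v Ku Kv; rewrite /KQ /= EL; exact: KP.
by rewrite /KQ /= (zmod_morphism0 (zmod_morphism_linear EL)).
Qed.

Lemma untwist_kernel_act n (F : 'I_n -> 'I_n -> H -> k) i j z :
  matrix_representation F -> KQ z -> KQ (tmap (fun x => x) (act (F i j)) z).
Proof.
move=> F_rep Kz; rewrite /KQ /= -[z](untwistK iota) -twist_hact // twistK.
by rewrite embl_hact //; exact: balancing_kernel_tact.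
Qed.

Lemma untwist_kernel_tmulr q z : KQ z -> KQ (tmulr q z).
Proof. by move=> Kz; rewrite /KQ /= embl_untwist_tmulr; exact: balancing_kernel_bimul. Qed.

Lemma untwist_kernel_pure1 x : KQ (x ⊗ 1) <-> I x.
Proof.
rewrite /KQ /= embl_untwist_pure IK.
suff -> t : bimul 1 1 t = t :> tensor Q Q by [].
move: t; apply: tensor_linear_ext => [||u v]; [exact: bimul_linear|exact: linear_idfun|].
by rewrite bimul_pure mul1r mulr1.
Qed.

Let KH : set (tensor H H) := [set z | KQ (embr iota z)].

Lemma embr_kernel_submod : submod_closed [in KH].
Proof.
have [K0 KP] := (submod_closedP _).1 untwist_kernel_submod.
have EL := embr_linear iota; apply/submod_closedP; split; last first.
  by move=> c u v Ku Kv; rewrite /KH /= EL; exact: KP.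
by rewrite /KH /= (zmod_morphism0 (zmod_morphism_linear EL)).
Qed.

Lemma embr_kernel_tmulr y z : KH z -> KH (tmulr y z).
Proof. by move=> Kz; rewrite /KH /= embr_tmulr; exact: untwist_kernel_tmulr. Qed.

Lemma embr_kernel_lact n (F : 'I_n -> 'I_n -> H -> k) i j z :
  matrix_representation F -> KH z -> KH (tmap (fun x => x) (lact (F i j)) z).
Proof.
move=> F_rep Kz.
have F_fin : finite_dual H (F i j) by case: F_rep => + _; apply.
have LL : linear (lact (F i j)) by apply: lact_linear; case: F_fin.
have AL : linear (act (F i j)) by exact: (act_linear Hact).
suff E : embr iota (tmap (fun x => x) (lact (F i j)) z) =
    tmap (fun x => x) (act (F i j)) (embr iota z).
  by rewrite /KH /= E; exact: untwist_kernel_act.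
have EL := embr_linear iota.
move: z {Kz}; apply: tensor_linear_ext => [||x y].
- by apply: linear_comp EL _; exact: tmap_linear.
- by apply: linear_comp _ EL; exact: tmap_linear.
- by rewrite embr_pure !tmap_pure // embr_pure (act_iota Hact).
Qed.

(* The Hopf module argument: a right subcomodule of [H (x) H] that is stable
   under right multiplication by [H] is generated by its elements [x (x) 1]. *)
Lemma embr_kernel_subtensor z : KH z -> subtensor I z.
Proof.
move=> Kz; pose Fs : set (H -> k^o) := [set f | exists n (F : 'I_n -> 'I_n -> H -> k) i j,
  matrix_representation F /\ f = F i j].
have Fs_lin f : Fs f -> linear f.
  by move=> [n [F [i [j [[F_fin _] ->]]]]]; case: (F_fin i j).
have Fs_sep x : (forall f, Fs f -> f x = 0) -> x = 0.
  move=> Fx; apply: (matrix_representation_separating Hfd) => n F i j F_rep.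
  by apply: Fx; exists n, F, i, j.
pose coact (z : tensor H H) : tensor (tensor H H) H :=
  tsum (fun x y => sweedler (fun a b => (x ⊗ a) ⊗ b) y) z.
have coactL : linear coact by rewrite /coact; linearity.
have coact_pure x y : coact (x ⊗ y) = sweedler (fun a b => (x ⊗ a) ⊗ b) y.
  by rewrite /coact tsum_bilinear //; linearity.
(* Contracting the last leg of [coact z] with [f] amounts to letting [f] act on the second factor of
   [z], which preserves [KH]. *)
have Kcoact : subtensor KH (coact z).
  apply: (subtensor_separating embr_kernel_submod Fs_lin Fs_sep) => f Ff.
  have fL := Fs_lin f Ff.
  have F2 : bilinear2 (fun (u : tensor H H) v => (f v : k) *: u) by linearity.
  have LL : linear (lact f) by exact: lact_linear.
  suff -> : tsum (fun (u : tensor H H) v => (f v : k) *: u) (coact z) =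
      tmap (fun x => x) (lact f) z.
    by case: Ff => n [F [i [j [F_rep ->]]]]; exact: embr_kernel_lact.
  move: (z); apply: tensor_linear_ext => [||x y].
  - exact: linear_comp (tsum_linear F2) coactL.
  - exact: tmap_linear.
  rewrite coact_pure tmap_pure // /lact.
  rewrite (@linear_sweedler _ _ _ _ (tsum _)); [|exact: tsum_linear|by linearity].
  rewrite (@linear_sweedler _ _ _ _ (tpure x)); try by linearity.
  by apply: eq_sweedler => a b; rewrite tsum_bilinear // tpureZr.
apply: (subtensor_separating IS Fs_lin Fs_sep) => f Ff; have fL := Fs_lin f Ff.
have F2 : bilinear2 (fun (u : H) v => (f v : k) *: u) by linearity.
apply/untwist_kernel_pure1; set x := tsum _ _.
suff : KH (x ⊗ 1) by rewrite /KH /= embr_pure rmorph1.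
have TL a : linear (fun u : tensor H H => tmulr a u) by exact: tmulr_linear.
have TL' (u : tensor H H) : linear (fun a => tmulr a u).
  by rewrite /tmulr /tmap; linearity.
have CB (u : tensor H H) : bilinear2 (fun a b => (f b : k) *: tmulr (S a) u).
  split=> a; last exact: linear_scalel.
  apply: linear_scaler; apply: (linear_comp (g := fun y => tmulr y u) (f := S)).
    exact: TL'.
  exact: linearP.
(* On [coact (x ⊗ y)] this gives [x ⊗ y_(1) S(y_(2))] weighted by [f y_(3)], that is
   [f y *: (x ⊗ 1)]; and it stays in [KH] since [KH] is stable under right multiplication. *)
pose contract (u : tensor H H) (y : H) :=
  sweedler (fun a b => (f b : k) *: tmulr (S a) u) y.
have C2 : bilinear2 contract.
  split=> a; last exact: sweedler_linear (CB a).
  by apply: linear_tsum_fun => [u|x' y]; [exact: CB|exact: linear_scaler (TL _)].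
have -> : x ⊗ 1 = tsum contract (coact z).
  rewrite {}/x; move: {Kz Kcoact} z; apply: tensor_linear_ext => [||x y].
  - apply: (linear_comp (g := fun x : H => x ⊗ (1 : H))); first by linearity.
    exact: tsum_linear.
  - exact: linear_comp (tsum_linear C2) coactL.
  rewrite tsum_bilinear // coact_pure.
  rewrite (@linear_sweedler _ _ _ _ (tsum contract)); [|exact: tsum_linear|by linearity].
  rewrite tpureZl -(@sweedler_mul_antipode_l _ _ _ (fun u d => (f d : k) *: (x ⊗ u)));
    last by linearity.
  apply: eq_sweedler => a b; rewrite tsum_bilinear // /contract.
  by apply: eq_sweedler => c d; rewrite tmulr_pure.
have KS := embr_kernel_submod; have [K0 KP] := (submod_closedP _).1 KS.
apply: (subtensor_tsum KS C2) Kcoact => u y Ku.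
rewrite /contract; apply: (@sweedler_set k H _ KH) => [||a b].
- exact: submod_closed_zmod KS.
- exact: bilinear2_balanced (CB u).
- by rewrite -[_ *: _]addr0; apply: KP => //; exact: embr_kernel_tmulr.
Qed.

Lemma subtensor_embr z : subtensor I z -> subtensor I (embr iota z).
Proof.
apply: subtensor_tsum; [exact: subtensor_closed|by linearity|].
by move=> x y Ix; exact: subtensor_pure.
Qed.

Lemma subtensor_tmulr (R : algType k) (q : R) (z : tensor H R) :
  subtensor I z -> subtensor I (tmulr q z).
Proof.
apply: subtensor_tsum; [exact: subtensor_closed|by linearity|].
by move=> x y Ix; exact: subtensor_pure.
Qed.

Hypothesis HQ : artinian_quotient_ring iota.

Lemma nonzerodivisorM (s t : H) :
  nonzerodivisor s -> nonzerodivisor t -> nonzerodivisor (s * t).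
Proof. by move=> [sl sr] [tl tr]; split; [exact: lregM|exact: rregM]. Qed.

Lemma nonzerodivisor_unit s : nonzerodivisor s -> iota s \is a GRing.unit.
Proof. by case: HQ => _ _ U _ _; exact: U. Qed.

Lemma right_fraction q : exists a s : H, nonzerodivisor s /\ q * iota s = iota a.
Proof.
case: HQ => _ _ _ /(_ q)[a [s [ns ->]]] _; exists a, s; split=> //.
by rewrite divrK // nonzerodivisor_unit.
Qed.

Lemma left_fraction q : exists a s : H, nonzerodivisor s /\ iota s * q = iota a.
Proof.
case: HQ => _ _ _ _ /(_ q)[a [s [ns ->]]]; exists a, s; split=> //.
by rewrite mulVKr // nonzerodivisor_unit.
Qed.

(** The Ore condition, read off from the right fraction representing [t^-1 s] in [Q]. *)
Lemma right_common_multiple s t : nonzerodivisor s -> nonzerodivisor t ->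
  exists c d : H, s * c = t * d /\ nonzerodivisor (s * c).
Proof.
move=> ns nt; have [a [c [nc E]]] := right_fraction ((iota t)^-1 * iota s).
exists c, a; split; last exact: nonzerodivisorM.
have [inj _ _ _ _] := HQ; apply: inj; rewrite !rmorphM /= -E mulrA mulVKr //.
exact: nonzerodivisor_unit.
Qed.

Lemma left_common_multiple s t : nonzerodivisor s -> nonzerodivisor t ->
  exists c d : H, c * s = d * t /\ nonzerodivisor (c * s).
Proof.
move=> ns nt; have [a [c [nc E]]] := left_fraction (iota s / iota t).
exists c, a; split; last exact: nonzerodivisorM.
have [inj _ _ _ _] := HQ; apply: inj; rewrite !rmorphM /= -E -mulrA divrK //.
exact: nonzerodivisor_unit.
Qed.

Lemma tmulr_tmulr (V : lmodType k) (R : algType k) (q r : R) (z : tensor V R) :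
  tmulr r (tmulr q z) = tmulr (q * r) z.
Proof.
have ML (p : R) : linear (@tmulr k V R p) by exact: tmulr_linear.
move: z; apply: tensor_linear_ext => [||u v]; last by rewrite !tmulr_pure mulrA.
  exact: linear_comp (ML r) (ML q).
exact: ML.
Qed.

Lemma tmulr1 (V : lmodType k) (R : algType k) (z : tensor V R) : tmulr 1 z = z.
Proof.
move: z; apply: tensor_linear_ext => [||u v]; last by rewrite tmulr_pure mulr1.
  exact: tmulr_linear.
exact: linear_idfun.
Qed.

(** A common denominator of the second factors; [right_common_multiple] merges those of two
    tensors. *)
Lemma right_denominator (z : tensor H Q) : exists (s : H) (z' : tensor H H),
  nonzerodivisor s /\ tmulr (iota s) z = embr iota z'.
Proof.
have ML (p : Q) := zmod_morphism_linear (@tmulr_linear k H Q p).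
have EL := zmod_morphism_linear (embr_linear iota).
move: z; apply: tensor_ind => [|z w [s [z' [ns Ez]]] [t [w' [nt Ew]]]|x q].
- exists 1, 0; split; first by split; [exact: lreg1|exact: rreg1].
  by rewrite (zmod_morphism0 (ML _)) (zmod_morphism0 EL).
- have [c [d [Ecd ncd]]] := right_common_multiple ns nt.
  exists (s * c), (tmulr c z' - tmulr d w'); split=> //.
  rewrite ML EL !embr_tmulr -Ez -Ew !tmulr_tmulr -!rmorphM.
  by rewrite Ecd.
- have [a [s [ns E]]] := right_fraction q.
  by exists s, (x ⊗ a); rewrite tmulr_pure embr_pure E.
Qed.

Lemma subtensor_tmulr_unit q (z : tensor H Q) : q \is a GRing.unit ->
  subtensor I (tmulr q z) -> subtensor I z.
Proof.
by move=> qU /(@subtensor_tmulr _ q^-1); rewrite tmulr_tmulr divrr // tmulr1.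
Qed.

(** After right multiplication by a denominator, [z] comes from [H ⊗ H], where the Hopf module
    argument applies; the denominator is a unit of [Q] and is removed again. *)
Lemma untwist_kernel_subtensor z : KQ z -> subtensor I z.
Proof.
have [s [z' [ns E]]] := right_denominator z.
move=> /(@untwist_kernel_tmulr (iota s)); rewrite E => /embr_kernel_subtensor.
move=> /subtensor_embr; rewrite -E.
exact: subtensor_tmulr_unit (nonzerodivisor_unit ns).
Qed.

End GaloisKernel.


(** * Stability of a two-sided [I] under the antipode *)

Section AntipodeStable.
Variables (k : fieldType) (H : hopfAlgType k) (Q : unitAlgType k).
Variable iota : {lrmorphism H -> Q}.
Variables (I : set H) (A : set Q).
Hypothesis HQ : artinian_quotient_ring iota.
Hypothesis I2 : two_sided_ideal I.
Hypothesis Aad : right_adjoint_stable iota A.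
Hypothesis untwist_subtensor : forall z,
  balancing_kernel A (embl iota (untwist iota z)) -> subtensor I z.

Local Notation S := (antipode : H -> H).
Local Notation K := (balancing_kernel A).

Let IS : submod_closed [in I]. Proof. by case: I2 => -[]. Qed.

(** A linear retraction of [iota], applied to the second factor, maps [I ⊗ Q] to [I ⊗ H]. *)
Lemma subtensor_embr_inv z : subtensor I (embr iota z) -> subtensor I z.
Proof.
have [inj _ _ _ _] := HQ.
have [r rK] := @linear_retraction k H Q iota inj.
have R2 : bilinear2 (fun (x : H) (y : Q) => x ⊗ r y) by linearity.
move=> Iz; suff <- : tsum (fun (x : H) (y : Q) => x ⊗ r y) (embr iota z) = z.
  apply: subtensor_tsum Iz => // [|x y Ix]; first exact: subtensor_closed.
  exact: subtensor_pure.
move: z {Iz}; apply: tensor_linear_ext => [||x y].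
- exact: linear_comp (tsum_linear R2) (embr_linear _).
- exact: linear_idfun.
- by rewrite embr_pure tsum_bilinear // rK.
Qed.

Lemma embl_inj : injective (embl iota).
Proof.
have [inj _ _ _ _] := HQ.
have [r rK] := @linear_retraction k H Q iota inj.
apply: (can_inj (g := tmap r (fun y => y))).
have RL : linear (tmap r (fun y : Q => y)) by apply: tmap_linear; linearity.
apply: tensor_linear_ext => [||x y].
- exact: linear_comp RL (embl_linear _).
- exact: linear_idfun.
- rewrite embl_pure tmap_pure ?rK //; linearity.
Qed.

(** The second factor is contracted with the linear form [counit (r y)] on [Q], which is [1] at [1]
    because [r] retracts [iota]. *)
Lemma subtensor_pure1 x : subtensor I (x ⊗ (1 : Q)) -> I x.
Proof.
have [inj _ _ _ _] := HQ.
have [r rK] := @linear_retraction k H Q iota inj.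
have R2 : bilinear2 (fun (x : H) (y : Q) => (counit (r y) : k) *: x) by linearity.
have [I0 IP] := (submod_closedP _).1 IS.
move=> Ix; suff -> : x = tsum (fun (x : H) (y : Q) => (counit (r y) : k) *: x) (x ⊗ 1).
  apply: subtensor_tsum Ix => // u y Iu.
  by rewrite -[_ *: _]addr0; exact: IP.
by rewrite tsum_bilinear // -(rmorph1 iota) rK rmorph1 scale1r.
Qed.

Lemma subtensor_tmull (R : algType k) (q : R) (z : tensor H R) :
  subtensor I z -> subtensor I (tmull q z).
Proof.
apply: subtensor_tsum; [exact: subtensor_closed|by linearity|].
by move=> x y Ix; exact: subtensor_pure.
Qed.

(* In Sweedler notation, [a_(1) (x) a_(2) = 1 (x) a] modulo [I (x) Q]. *)
Lemma coinvariant_mulr a t g : A a -> a * iota t = iota g ->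
  subtensor I (sweedler (fun x y => x ⊗ (a * iota y)) t -
               sweedler (fun x y => x ⊗ iota y) g).
Proof.
move=> Aa E; apply: untwist_subtensor.
pose phi (z : tensor H Q) := embl iota (untwist iota z).
have phiL : linear phi by exact: linear_comp (embl_linear _) (untwist_linear _).
have phi_pure x q : phi (x ⊗ q) = sweedler (fun c d => iota c ⊗ (iota (S d) * q)) x.
  rewrite /phi embl_untwist_pure /galois_elt (@linear_sweedler _ _ _ _ (bimul 1 q));
    [|exact: bimul_linear|by linearity].
  by apply: eq_sweedler => c d; rewrite bimul_pure mul1r.
have AL := right_adjoint_linear iota a.
rewrite -/(phi _) (zmod_morphism_linear phiL).
rewrite !(@linear_sweedler _ _ _ _ phi) //; try by linearity.
(* Under [phi] the first sum becomes [t_(1) ⊗ (a <| t_(2))] and the second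
   [g ⊗ 1 = t_(1) (a <| t_(2)) ⊗ 1]. They differ by balancing relations, as [A] is stable under
   [<|]. *)
have -> : sweedler (fun x y => phi (x ⊗ (a * iota y))) t =
    sweedler (fun x y => iota x ⊗ right_adjoint iota a y) t.
  transitivity (sweedler (fun x y => sweedler (fun c d =>
      iota c ⊗ (iota (S d) * (a * iota y))) x) t).
    by apply: eq_sweedler => x y; rewrite phi_pure.
  rewrite (@sweedler_coassoc _ _ _ (fun c d y => iota c ⊗ (iota (S d) * (a * iota y))));
    last by linearity.
  apply: eq_sweedler => x y; rewrite /right_adjoint.
  rewrite (@linear_sweedler _ _ _ _ (tpure (iota x))); try by linearity.
  by apply: eq_sweedler => c d; rewrite mulrA.
have -> : sweedler (fun x y => phi (x ⊗ iota y)) g =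
    sweedler (fun x y => (iota x * right_adjoint iota a y) ⊗ 1) t.
  transitivity (iota g ⊗ (1 : Q)).
    transitivity (sweedler (fun x y => sweedler (fun c d =>
        iota c ⊗ iota (S d * y)) x) g).
      apply: eq_sweedler => x y; rewrite phi_pure.
      by apply: eq_sweedler => c d; rewrite rmorphM.
    rewrite (@sweedler_coassoc _ _ _ (fun c d y => iota c ⊗ iota (S d * y)));
      last by linearity.
    rewrite (@sweedler_antipode_mul_r _ _ _ (fun c m => iota c ⊗ iota m));
      last by linearity.
    by rewrite rmorph1.
  rewrite -E; transitivity ((iota 1 * a * iota t) ⊗ (1 : Q)).
    by rewrite rmorph1 mul1r.
  rewrite -(@sweedler_mul_antipode_l _ _ _ (fun u e => (iota u * a * iota e) ⊗ (1 : Q)));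
    last by linearity.
  apply: eq_sweedler => x y; rewrite /right_adjoint.
  rewrite (@linear_sweedler _ _ _ _ (fun u : Q => (iota x * u) ⊗ (1 : Q)));
    try by linearity.
  by apply: eq_sweedler => c d; rewrite rmorphM !mulrA.
rewrite -sweedlerB; try by linearity.
apply: (@sweedler_set _ _ _ K) => [||x y].
- exact: balancing_kernel_closed.
- by apply: bilinear2_balanced; linearity.
have [K0 KB] := (zmod_closedP _).1 (balancing_kernel_closed A).
rewrite -opprB -sub0r; apply: (KB) => //; apply: sub_gen_smallest.
exists (iota x), (right_adjoint iota a y), 1; rewrite mulr1; split=> //.
exact: Aad.
Qed.

(** An automorphism of [H ⊗ H] with inverse [runtwist]; both preserve [I ⊗ H] because [I] is a right
    ideal. *)
Definition rtwist : tensor H H -> tensor H H :=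
  tsum (fun u h => sweedler (fun c d => (u * c) ⊗ d) h).

Definition runtwist : tensor H H -> tensor H H :=
  tsum (fun u h => sweedler (fun c d => (u * S c) ⊗ d) h).

Lemma rtwist_linear : linear rtwist.
Proof. by rewrite /rtwist; linearity. Qed.

Lemma runtwist_linear : linear runtwist.
Proof. by rewrite /runtwist; linearity. Qed.

Lemma rtwist_pure u h : rtwist (u ⊗ h) = sweedler (fun c d => (u * c) ⊗ d) h.
Proof. by rewrite /rtwist tsum_bilinear //; linearity. Qed.

Lemma runtwist_pure u h : runtwist (u ⊗ h) = sweedler (fun c d => (u * S c) ⊗ d) h.
Proof. by rewrite /runtwist tsum_bilinear //; linearity. Qed.

Lemma rtwistK : cancel rtwist runtwist.
Proof.
have TL := rtwist_linear; have UL := runtwist_linear.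
apply: tensor_linear_ext => [||u h]; [exact: linear_comp|exact: linear_idfun|].
rewrite rtwist_pure (@linear_sweedler _ _ _ _ runtwist) //; last by linearity.
transitivity ((u * 1) ⊗ h); last by rewrite mulr1.
rewrite -(@sweedler_mul_antipode_l _ _ _ (fun m e => (u * m) ⊗ e)); last by linearity.
apply: eq_sweedler => a b; rewrite runtwist_pure.
by apply: eq_sweedler => c d; rewrite mulrA.
Qed.

Lemma runtwistK : cancel runtwist rtwist.
Proof.
have TL := rtwist_linear; have UL := runtwist_linear.
apply: tensor_linear_ext => [||u h]; [exact: linear_comp|exact: linear_idfun|].
rewrite runtwist_pure (@linear_sweedler _ _ _ _ rtwist) //; last by linearity.
transitivity ((u * 1) ⊗ h); last by rewrite mulr1.
rewrite -(@sweedler_antipode_mul_l _ _ _ (fun m e => (u * m) ⊗ e)); last by linearity.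
apply: eq_sweedler => a b; rewrite rtwist_pure.
by apply: eq_sweedler => c d; rewrite mulrA.
Qed.

Lemma subtensor_rtwist z : subtensor I z -> subtensor I (rtwist z).
Proof.
have SC := @subtensor_closed k H I H.
apply: subtensor_tsum; [exact: SC|by linearity|] => x y Ix.
apply: (@sweedler_set _ _ _ (@subtensor k H I H)) => [||a b].
- exact: submod_closed_zmod SC.
- by apply: bilinear2_balanced; linearity.
- by apply: subtensor_pure; exact: I2.2.
Qed.

Lemma subtensor_runtwist z : subtensor I z -> subtensor I (runtwist z).
Proof.
have SC := @subtensor_closed k H I H.
apply: subtensor_tsum; [exact: SC|by linearity|] => x y Ix.
apply: (@sweedler_set _ _ _ (@subtensor k H I H)) => [||a b].
- exact: submod_closed_zmod SC.
- by apply: bilinear2_balanced; linearity.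
- by apply: subtensor_pure; exact: I2.2.
Qed.

(** In [S(b_(1)) b_(2) t_(1) ⊗ b_(3) t_(2)] the first two factors cancel. *)
Lemma rtwist_antipode b t :
  rtwist (sweedler (fun x y => S x ⊗ (y * t)) b) =
  sweedler (fun c d => c ⊗ (b * d)) t.
Proof.
rewrite (@linear_sweedler _ _ _ _ rtwist); [|exact: rtwist_linear|by linearity].
transitivity (sweedler (fun c d => (1 * c) ⊗ (b * d)) t); last first.
  by apply: eq_sweedler => c d; rewrite mul1r.
rewrite -(@sweedler_antipode_mul_l _ _ _ (fun u e =>
  sweedler (fun c d => (u * c) ⊗ (e * d)) t)); last by linearity.
apply: eq_sweedler => x y; rewrite rtwist_pure sweedlerM; last by linearity.
by apply: eq_sweedler => c d; apply: eq_sweedler => e f; rewrite mulrA.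
Qed.

(* In Sweedler notation, [S(a_(1)) (x) a_(2) = 1 (x) a] modulo [I (x) Q]. *)
Lemma antipode_coinvariant_mull a p b : A a -> iota p * a = iota b ->
  subtensor I (sweedler (fun x y => S x ⊗ iota y) b -
               sweedler (fun x y => S x ⊗ (iota y * a)) p).
Proof.
move=> Aa E; have [g [t [nt Eg]]] := right_fraction HQ a.
apply: (subtensor_tmulr_unit (nonzerodivisor_unit HQ nt)).
(* This is the difference multiplied on the right by [t]; as [a t = g], it comes from [H ⊗ H]. *)
pose Y := sweedler (fun x y => S x ⊗ (y * t)) b - sweedler (fun x y => S x ⊗ (y * g)) p.
have ML := zmod_morphism_linear (@tmulr_linear k H Q (iota t)).
have EL := zmod_morphism_linear (embr_linear iota).
have RL := zmod_morphism_linear rtwist_linear.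
have LL := zmod_morphism_linear (@tmull_linear k H Q (iota p)).
have -> : tmulr (iota t) (sweedler (fun x y => S x ⊗ iota y) b -
    sweedler (fun x y => S x ⊗ (iota y * a)) p) = embr iota Y.
  rewrite /Y ML EL !(@linear_sweedler _ _ _ _ (tmulr (iota t)));
    try by [exact: tmulr_linear|linearity].
  rewrite !(@linear_sweedler _ _ _ _ (embr iota)); try by [exact: embr_linear|linearity].
  congr (_ - _); apply: eq_sweedler => x y; rewrite tmulr_pure embr_pure rmorphM //=.
  by rewrite -Eg mulrA.
apply: subtensor_embr; rewrite -[Y]rtwistK; apply: subtensor_runtwist.
apply: subtensor_embr_inv.
(* Since [b = p a], [rtwist_antipode] exhibits [rtwist Y] as the element of [coinvariant_mulr] with
   second factor multiplied on the left by [p]. *)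
have -> : embr iota (rtwist Y) = tmull (iota p)
    (sweedler (fun x y => x ⊗ (a * iota y)) t - sweedler (fun x y => x ⊗ iota y) g).
  rewrite /Y RL EL LL !rtwist_antipode.
  rewrite !(@linear_sweedler _ _ _ _ (embr iota)); try by [exact: embr_linear|linearity].
  rewrite !(@linear_sweedler _ _ _ _ (tmull (iota p)));
    try by [exact: tmull_linear|linearity].
  congr (_ - _); apply: eq_sweedler => x y; rewrite tmull_pure embr_pure rmorphM //=.
  by rewrite mulrA E.
by apply: subtensor_tmull; exact: coinvariant_mulr.
Qed.

Definition antitwist : tensor H Q -> tensor H Q :=
  tsum (fun p q => sweedler (fun x y => S x ⊗ (iota y * q)) p).

Lemma antitwist_linear : linear antitwist.
Proof. by rewrite /antitwist; linearity. Qed.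

Lemma antitwist_pure p q :
  antitwist (p ⊗ q) = sweedler (fun x y => S x ⊗ (iota y * q)) p.
Proof. by rewrite /antitwist tsum_bilinear //; linearity. Qed.

(** What left multiplication of the first factor by [h] becomes after [antitwist]: as [S] reverses
    products, [S(h_(1))] appears on the right of the first factor. *)
Definition antitwist_mull (h : H) : tensor H Q -> tensor H Q :=
  tsum (fun u q => sweedler (fun x y => (u * S x) ⊗ (iota y * q)) h).

Lemma antitwist_mull_pure h u q :
  antitwist_mull h (u ⊗ q) = sweedler (fun x y => (u * S x) ⊗ (iota y * q)) h.
Proof. by rewrite /antitwist_mull tsum_bilinear //; linearity. Qed.

Definition lmull (h : H) : tensor H Q -> tensor H Q :=
  tmap (fun p => h * p) (fun q => q).

Lemma lmull_linear h : linear (lmull h).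
Proof. by apply: tmap_linear; linearity. Qed.

Lemma lmull_pure h p q : lmull h (p ⊗ q) = (h * p) ⊗ q.
Proof. by apply: tmap_pure; linearity. Qed.

Lemma embl_lmull h z : embl iota (lmull h z) = bimul (iota h) 1 (embl iota z).
Proof.
have EL := embl_linear iota; have LL := lmull_linear h.
have BL := @bimul_linear k Q (iota h) 1.
move: z; apply: tensor_linear_ext => [||p q].
- exact: linear_comp EL LL.
- exact: linear_comp BL EL.
- by rewrite lmull_pure !embl_pure bimul_pure mulr1 rmorphM.
Qed.

Lemma antitwist_lmull h z : antitwist (lmull h z) = antitwist_mull h (antitwist z).
Proof.
have TL := antitwist_linear; have LL := lmull_linear h.
have ML : linear (antitwist_mull h) by rewrite /antitwist_mull; linearity.
move: z; apply: tensor_linear_ext => [||p q].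
- exact: linear_comp TL LL.
- exact: linear_comp ML TL.
rewrite lmull_pure !antitwist_pure (@linear_sweedler _ _ _ _ (antitwist_mull h));
  [|exact: ML|by linearity].
rewrite sweedlerM; last by linearity.
rewrite (@exchange_sweedler _ _ _ (fun a b c d => S (a * c) ⊗ (iota (b * d) * q)));
  try by linearity.
apply: eq_sweedler => c d; rewrite antitwist_mull_pure.
by apply: eq_sweedler => a b; rewrite antipodeM rmorphM mulrA.
Qed.

Lemma subtensor_antitwist_mull h z :
  subtensor I z -> subtensor I (antitwist_mull h z).
Proof.
have SC := @subtensor_closed k H I Q.
apply: subtensor_tsum; [exact: SC|by linearity|] => x y Ix.
apply: (@sweedler_set _ _ _ (@subtensor k H I Q)) => [||a b].
- exact: submod_closed_zmod SC.
- by apply: bilinear2_balanced; linearity.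
- by apply: subtensor_pure; exact: I2.2.
Qed.

(* Denominators on the left are cleared because [antitwist] makes sense on
   [H (x) Q] only. *)
Lemma balancing_kernel_antitwist t : K t ->
  exists (r : H) (z : tensor H Q), [/\ nonzerodivisor r,
    bimul (iota r) 1 t = embl iota z & subtensor I (antitwist z)].
Proof.
pose N := [set t | exists (r : H) (z : tensor H Q), [/\ nonzerodivisor r,
  bimul (iota r) 1 t = embl iota z & subtensor I (antitwist z)]].
have EL := zmod_morphism_linear (embl_linear iota).
have TL := zmod_morphism_linear antitwist_linear.
have BL p := zmod_morphism_linear (@bimul_linear k Q p 1).
have [_ SB] := (zmod_closedP _).1 (submod_closed_zmod (@subtensor_closed k H I Q)).
have [S0 _] := (zmod_closedP _).1 (submod_closed_zmod (@subtensor_closed k H I Q)).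
apply: (@smallest_sub _ _ _ N) => [|_ [p [a [q [Aa ->]]]]].
  apply/zmod_closedP; split=> [|u v [r [z [nr Er Iz]]] [s [w [ns Es Iw]]]].
    exists 1, 0; split; first by split; [exact: lreg1|exact: rreg1].
      by rewrite (zmod_morphism0 (BL _)) (zmod_morphism0 EL).
    by rewrite (zmod_morphism0 TL).
  (* A common left multiple of the two denominators serves for the difference; the new factors [c]
     and [d] act through [antitwist_mull], which preserves [I ⊗ Q]. *)
  have [c [d [Ecd ncr]]] := left_common_multiple HQ nr ns.
  exists (c * r), (lmull c z - lmull d w); split=> //.
    rewrite BL EL !embl_lmull -Er -Es !bimul_bimul -!rmorphM /= mulr1.
    by rewrite Ecd.
  by rewrite TL !antitwist_lmull; apply: SB; exact: subtensor_antitwist_mull.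
(* Here [r1 p = p1], and next [r2 p1 a = b], so [r2 r1] clears the denominators of both [p] and
   [p a]. *)
have [p1 [r1 [n1 E1]]] := left_fraction HQ p.
have [b [r2 [n2 E2]]] := left_fraction HQ (iota p1 * a).
exists (r2 * r1), (b ⊗ q - (r2 * p1) ⊗ (a * q)); split; first exact: nonzerodivisorM.
  by rewrite BL EL !bimul_pure !embl_pure !mulr1 -E2 !rmorphM /= -E1 !mulrA.
have -> : antitwist (b ⊗ q - (r2 * p1) ⊗ (a * q)) =
    tmulr q (sweedler (fun x y => S x ⊗ iota y) b -
      sweedler (fun x y => S x ⊗ (iota y * a)) (r2 * p1)).
  have ML := zmod_morphism_linear (@tmulr_linear k H Q q).
  rewrite TL ML !antitwist_pure.
  rewrite !(@linear_sweedler _ _ _ _ (tmulr q)); try by [exact: tmulr_linear|linearity].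
  congr (_ - _); apply: eq_sweedler => x y; rewrite tmulr_pure; first by [].
  by rewrite mulrA.
apply: subtensor_tmulr; apply: antipode_coinvariant_mull => //.
by rewrite rmorphM /= -mulrA.
Qed.

(** Without denominators, [antitwist] has the value [S(x_(1)) ⊗ x_(2) S(x_(3)) = S(x) ⊗ 1]. A left
    denominator [r] changes it into the image of [runtwist (S x ⊗ r)]; applying [rtwist] leaves
    [S x ⊗ r] in [I ⊗ H], and [r] is a unit of [Q]. *)
Lemma antipode_closed x : K (galois_elt iota x) -> I (S x).
Proof.
move=> /balancing_kernel_antitwist[r [z [nr Ez Iz]]].
pose z0 := sweedler (fun a b => a ⊗ iota (S b)) x.
have Ez0 : z = lmull r z0.
  apply: embl_inj; rewrite -Ez embl_lmull; congr (bimul _ _ _).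
  rewrite /z0 (@linear_sweedler _ _ _ _ (embl iota)); [|exact: embl_linear|by linearity].
  by apply: eq_sweedler => a b; rewrite embl_pure.
have Tz0 : antitwist z0 = S x ⊗ 1.
  rewrite /z0 (@linear_sweedler _ _ _ _ antitwist); [|exact: antitwist_linear|by linearity].
  rewrite -(rmorph1 iota).
  rewrite -(@sweedler_mul_antipode_r _ _ _ (fun c m => S c ⊗ iota m)); last by linearity.
  rewrite -(@sweedler_coassoc _ _ _ (fun a c d => S a ⊗ iota (c * S d))); last by linearity.
  apply: eq_sweedler => a b; rewrite antitwist_pure.
  by apply: eq_sweedler => c d; rewrite rmorphM.
move: Iz; rewrite Ez0 antitwist_lmull Tz0 antitwist_mull_pure => Iz.
have Er : embr iota (runtwist (S x ⊗ r)) =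
    sweedler (fun a b => (S x * S a) ⊗ (iota b * 1)) r.
  rewrite runtwist_pure (@linear_sweedler _ _ _ _ (embr iota));
    [|exact: embr_linear|by linearity].
  by apply: eq_sweedler => a b; rewrite embr_pure mulr1.
move: Iz; rewrite -Er => /subtensor_embr_inv/subtensor_rtwist; rewrite runtwistK.
move=> /(@subtensor_embr _ _ _ iota); rewrite embr_pure => Ixr.
apply: subtensor_pure1; apply: (subtensor_tmulr_unit (nonzerodivisor_unit HQ nr)).
by rewrite tmulr_pure mul1r.
Qed.

End AntipodeStable.

Theorem theorem10p1 (k : fieldType) (H : hopfAlgType k) (Q : unitAlgType k)
    (iota : {lrmorphism H -> Q}) (act : (H -> k) -> Q -> Q)
    (Hfd : residually_finite_dim H)
    (HQ : artinian_quotient_ring iota)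
    (Hact : extended_action iota act)
    (I : set H) (A : set Q)
    (HI : coideal_left_ideal I)
    (HA : invariant_artinian_subalgebra act A)
    (HIA : corresponding iota I A) :
  [<-> biideal I; hopf_ideal I; right_adjoint_stable iota A].
Proof.
have [CI LI] := HI; have [AS _ _ Aact] := HA; have [IE AE] := HIA.
have IK x : I x <-> balancing_kernel A (galois_elt iota x).
  by rewrite {1}IE /= opure_galois_elt.
have IS : submod_closed [in I] by case: LI.
(* Established before the cycle of implications, as the passage from biideal to Hopf ideal relies on
   it too. *)
have ad : two_sided_ideal I -> right_adjoint_stable iota A.
  by move=> I2; exact: two_sided_right_adjoint_stable I2 AE.
tfae.
- move=> [_ I2]; split=> // x /IK Kx; apply: (antipode_closed HQ I2 (ad I2) _ Kx) => z.
  exact: (untwist_kernel_subtensor Hfd Hact Aact IS IK HQ).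
- by move=> [[_ I2] _]; exact: ad.
- by move=> Aad; split=> //; exact: right_adjoint_stable_two_sided AS LI IE Aad.
Qed.
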